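(* For any Gauss-Markov driver $(D_t)_{t\in[T_0,T_n]}$, there exists an arcade process $(A_t^{(n)})_{t\in[T_0,T_n]}$ on $\{T_0,T_n\}_*$, driven by $(D_t)$, that is Markovian (with respect to its own filtration).
   Context: Fix dates $0\leqslant T_0<T_1<\dots<T_n<\infty$, $n\geqslant 1$; $\{T_0,T_n\}_*:=\{T_0,T_1,\dots,T_n\}$ and $(T_0,T_n)_*:=\bigcup_{i=0}^{n-1}(T_i,T_{i+1})$. A driver is a real sample-continuous stochastic process $(D_t)_{t\in[T_0,T_n]}$ on a probability space $(\Omega,\mathcal F,\mathbb P)$ such that for all $c\in\mathbb{R}$, $\mathbb P[D_t=c]<1$ for all $t\in(T_0,T_n)_*$; it is Gauss-Markov if it is a Gaussian process and a Markov process. Functions $f_0,\dots,f_n\in C^0([T_0,T_n],\mathbb{R})$ are interpolating coefficients on $\{T_0,T_n\}_*$ if $f_i(T_i)=1$ and $f_i(T_j)=0$ for all $i\ne j$. An arcade process (AP) on $\{T_0,T_n\}_*$ driven by $(D_t)$ is a process of the form $A_t^{(n)}:=D_t-\sum_{i=0}^n f_i(t)D_{T_i}$, where $f_0,\dots,f_n$ are interpolating coefficients on $\{T_0,T_n\}_*$; its own filtration is $\mathcal F^A_t=\sigma(A^{(n)}_u: T_0\leqslant u\leqslant t)$. *)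

(* Defs.v *)
From HB Require Import structures.
From mathcomp Require Import all_boot all_order all_algebra.
From mathcomp Require Import all_classical all_reals all_analysis.
Set Implicit Arguments.
Unset Strict Implicit.
Unset Printing Implicit Defensive.
Import Order.TTheory GRing.Theory Num.Theory.
Import numFieldNormedType.Exports.
Local Open Scope classical_set_scope.
Local Open Scope ring_scope.

(* A process with time set [a, b] is a total function [X : R -> Omega -> R];
   the values [X t] for [t] outside of [a, b] are irrelevant. *)

Section Processes.
Context {d : measure_display} {Omega : measurableType d} {R : realType}.
Variable P : probability Omega R.

Definition is_process (a b : R) (X : R -> Omega -> R) : Prop :=
  forall t, t \in `[a, b] -> measurable_fun [set: Omega] (X t).

Definition sample_continuous (a b : R) (X : R -> Omega -> R) : Prop :=
  {ae P, forall w, {within `[a, b], continuous (fun t => X t w)}}.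

(* The case [s = 0] is the degenerate Gaussian law; it is treated apart because
   [normal_prob m 0] is not a Dirac measure. *)
Definition gaussian_rv (Y : Omega -> R) : Prop :=
  exists m s : R, 0 <= s /\
    forall B : set R, measurable B ->
      P (Y @^-1` B) = if s == 0 then \d_m B else normal_prob m s B.

Definition gaussian_process (a b : R) (X : R -> Omega -> R) : Prop :=
  forall (k : nat) (t c : 'I_k -> R), (forall i, t i \in `[a, b]) ->
    gaussian_rv (fun w => \sum_(i < k) c i * X (t i) w).

Definition sigma_generated (J : set R) (X : R -> Omega -> R) :
    set (set Omega) :=
  <<s \bigcup_(u in J)
        preimage_set_system [set: Omega] (X u) (@measurable _ R) >>.

Definition own_filtration (a : R) (X : R -> Omega -> R) (t : R) :
    set (set Omega) :=
  sigma_generated `[a, t] X.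

(* [Y] is a version of the conditional probability P[E | G]. *)
Definition cond_prob_version (G : set (set Omega)) (E : set Omega)
    (Y : Omega -> R) : Prop :=
  [/\ preimage_set_system [set: Omega] Y (@measurable _ R) `<=` G,
      P.-integrable [set: Omega] (fun w => (Y w)%:E) &
      forall A, G A -> (\int[P]_(w in A) (Y w)%:E = P (E `&` A))%E].

(* P[X_t \in B | F^X_s] = P[X_t \in B | sigma(X_s)] almost surely, written as
   the existence of a common version of the two conditional probabilities. *)
Definition markov_process (a b : R) (X : R -> Omega -> R) : Prop :=
  forall s t : R, s \in `[a, b] -> t \in `[a, b] -> s <= t ->
  forall B : set R, measurable B ->
  exists Y : Omega -> R,
    cond_prob_version (own_filtration a X s) (X t @^-1` B) Y /\
    cond_prob_version (sigma_generated [set s] X) (X t @^-1` B) Y.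

Section Arcade.
Context {n : nat}.
Variable T : 'I_n.+1 -> R.

Definition open_arcs : set R :=
  \bigcup_(i in [set: 'I_n]) [set` `]T (widen_ord (leqnSn n) i), T (lift ord0 i)[].

Definition driver (D : R -> Omega -> R) : Prop :=
  [/\ is_process (T ord0) (T ord_max) D,
      sample_continuous (T ord0) (T ord_max) D &
      forall (c t : R), open_arcs t -> (P [set w | D t w = c] < 1)%E].

Definition gauss_markov_driver (D : R -> Omega -> R) : Prop :=
  [/\ driver D,
      gaussian_process (T ord0) (T ord_max) D &
      markov_process (T ord0) (T ord_max) D].

Definition interpolating_coefficients (f : 'I_n.+1 -> R -> R) : Prop :=
  (forall i, {within `[T ord0, T ord_max], continuous (f i)}) /\
  (forall i j, f i (T j) = (i == j)%:R).

Definition arcade (f : 'I_n.+1 -> R -> R) (D : R -> Omega -> R) :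
    R -> Omega -> R :=
  fun t w => D t w - \sum_(i < n.+1) f i t * D (T i) w.

Definition arcade_process (D A : R -> Omega -> R) : Prop :=
  exists2 f, interpolating_coefficients f &
    forall t, t \in `[T ord0, T ord_max] -> A t = arcade f D t.

End Arcade.
End Processes.

(* Main.v *)
Require Import Defs.
From HB Require Import structures.
From mathcomp Require Import all_boot all_order all_algebra.
From mathcomp Require Import all_classical all_reals all_analysis.
From mathcomp Require Import measurable_realfun ring lra.
Set Implicit Arguments.
Unset Strict Implicit.
Unset Printing Implicit Defensive.
Import Order.TTheory GRing.Theory Num.Theory.
Import numFieldNormedType.Exports.
Local Open Scope classical_set_scope.
Local Open Scope ring_scope.

(** The arcade process is, up to its mean, the residual of the linear regression
of [D t] on all the values [D (T 0)], ..., [D (T n)] of the driver at the dates.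
Conditioning a Markov process on its values at fixed dates leaves it Markov, and
for a Gaussian process conditioning amounts to subtracting a regression.

To get regression coefficients that are continuous in [t] and interpolate, even
if the Gram matrix of the [D (T j)] is singular, the residual is computed in two
steps.  Lagrange polynomials [L i] first give [W t = D t - \sum_i L i t * D (T i)],
which vanishes at the dates; then the covariances of [W t] with the [D (T j)] are
multiplied by a pseudo-inverse of the Gram matrix ([regression]).  This correction
vanishes at the dates because [W] does, and it is continuous because the
covariance of a sample-continuous Gaussian process is ([continuous_cov]).

The Markov property is a statement about covariances.  On the one hand, if [D] is
Markov and [r <= s <= t], the part of [D r] that is not explained by [D s] is
independent of [D s], hence, by the Markov property, of [D t]
([markov_uncorrelated]).  On the other hand, if the part of [A t] that is not
explained by [A s] is uncorrelated with the past of [A], then it is independent of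
that past, and the law of [A t] given the past is that of a function of [A s] plus
independent noise ([markov_of_uncorrelated]).  Between the two there is only
Euclidean geometry ([residual_markov]): given [D s], the span of the past values
and the span of the future values are orthogonal, and this persists after
projecting away some past values and some future values.

Independence of uncorrelated jointly Gaussian variables is the analytic core.  The
normal law has characteristic function [exp (i m a - s^2 a^2 / 2)], by the usual
differential equation ([gauss_fourier]), which makes the trigonometric functions
of uncorrelated variables multiplicative ([orthogonal_phases]); and trigonometric
functions determine a law, since indicators of half-lines are iterated bounded
pointwise limits of trigonometric polynomials ([bp_ray], [trig_orthogonal]). *)

(** * Bounded pointwise limits *)

Lemma dominated_cvg_Rintegral d (T : measurableType d) (R : realType)
    (mu : {measure set T -> \bar R}) (u : nat -> T -> R) (f g : T -> R) :
  (forall n, measurable_fun [set: T] (u n)) -> measurable_fun [set: T] f ->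
  mu.-integrable [set: T] (EFin \o g) ->
  (forall n x, `|u n x| <= g x) ->
  {ae mu, forall x, u n x @[n --> \oo] --> f x} ->
  \int[mu]_x u n x @[n --> \oo] --> \int[mu]_x f x.
Proof.
move=> mu_ mf ig ug uf.
have aef : {ae mu, forall x, [set: T] x ->
    (u n x)%:E @[n --> \oo] --> (f x)%:E}.
  by apply: filterS uf => x ux _; apply: cvg_EFin; [exact: nearW|exact: ux].
have mEu n : measurable_fun [set: T] (EFin \o u n) by exact/measurable_EFinP.
have mEf : measurable_fun [set: T] (EFin \o f) by exact/measurable_EFinP.
have ugE : {ae mu, forall x n, [set: T] x -> (`|(u n x)%:E| <= (EFin \o g) x)%E}.
  by apply: aeW => x n _; rewrite /= lee_fin.
have [intf _ cvu] := @dominated_convergence _ _ _ mu _ measurableT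
  (fun n x => (u n x)%:E) (EFin \o f) (EFin \o g) mEu mEf aef ig ugE.
apply: fine_cvg; rewrite fineK; first exact: cvu.
by apply: integrable_fin_num.
Qed.

Section bounded_measurable.
Context d (T : measurableType d) (R : realType).
Variable P : probability T R.

Definition bmeas (f : T -> R) : Prop :=
  measurable_fun [set: T] f /\ exists M : R, forall x, `|f x| <= M.

Lemma bmeas_integrable f : bmeas f -> P.-integrable [set: T] (EFin \o f).
Proof.
move=> [mf [M fM]]; apply: (@le_integrable _ _ _ P _ measurableT _ (EFin \o cst M)).
- exact/measurable_EFinP.
- by move=> x _ /=; rewrite lee_fin ler_normr fM.
- exact: finite_measure_integrable_cst.
Qed.

Lemma bmeas_cst c : bmeas (fun=> c).
Proof. by split; [exact: measurable_cst|exists `|c|]. Qed.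

Lemma bmeasD f g : bmeas f -> bmeas g -> bmeas (fun x => f x + g x).
Proof.
move=> [mf [M fM]] [mg [N gN]]; split; first exact: measurable_funD.
exists (M + N) => x; exact: le_trans (ler_normD _ _) (lerD _ _).
Qed.

Lemma bmeasM f g : bmeas f -> bmeas g -> bmeas (fun x => f x * g x).
Proof.
move=> [mf [M fM]] [mg [N gN]]; split; first exact: measurable_funM.
by exists (M * N) => x; rewrite normrM ler_pM.
Qed.

Lemma bmeas_indic (A : set T) : measurable A -> bmeas \1_A.
Proof.
move=> mA; split; first exact: measurable_indic.
by exists 1 => x; rewrite indicE; case: (x \in A); rewrite ?normr1 ?normr0.
Qed.

Lemma bmeas_cos f : measurable_fun [set: T] f -> bmeas (fun x => cos (f x)).
Proof.
move=> mf; split; last by exists 1 => x; exact: cos_max.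
exact: (measurableT_comp (continuous_measurable_fun (@continuous_cos R)) mf).
Qed.

Lemma bmeas_sin f : measurable_fun [set: T] f -> bmeas (fun x => sin (f x)).
Proof.
move=> mf; split; last by exists 1 => x; exact: sin_max.
exact: (measurableT_comp (continuous_measurable_fun (@continuous_sin R)) mf).
Qed.

End bounded_measurable.

(** The functional form of the monotone class argument: it replaces a
pi-lambda system by a linear space, on which products can be treated by
induction. *)
Inductive bp_closure (T : Type) (R : realType) (C : set (T -> R)) :
    (T -> R) -> Prop :=
| bp_base f : C f -> bp_closure C f
| bp_lin a f g : bp_closure C f -> bp_closure C g ->
    bp_closure C (fun x => a * f x + g x)
| bp_lim (u : nat -> T -> R) f M : (forall n, bp_closure C (u n)) ->
    (forall n x, `|u n x| <= M) -> (forall x, u n x @[n --> \oo] --> f x) ->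
    bp_closure C f.

Section bp_closure.
Context (T : Type) (R : realType) (C : set (T -> R)).
Hypothesis Cone : C (fun=> 1).
Hypothesis Cbound : forall f, C f -> exists M : R, forall x, `|f x| <= M.
Hypothesis CM : forall f g, C f -> C g -> bp_closure C (fun x => f x * g x).
Local Notation cl := (bp_closure C).

Lemma bp_zero : cl (fun=> 0).
Proof.
have := bp_lin (-1) (bp_base Cone) (bp_base Cone).
by congr bp_closure; apply/funext => x; ring.
Qed.

Lemma bpZ a f : cl f -> cl (fun x => a * f x).
Proof.
move=> clf; have := bp_lin a clf bp_zero.
by congr bp_closure; apply/funext => x; ring.
Qed.

Lemma bp_cst a : cl (fun=> a).
Proof.
by have := bpZ a (bp_base Cone); congr bp_closure; apply/funext => x; ring.
Qed.

Lemma bpD f g : cl f -> cl g -> cl (fun x => f x + g x).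
Proof.
move=> clf clg; have := bp_lin 1 clf clg.
by congr bp_closure; apply/funext => x; ring.
Qed.

Lemma bpB f g : cl f -> cl g -> cl (fun x => f x - g x).
Proof.
move=> clf clg; have := bp_lin (-1) clg clf.
by congr bp_closure; apply/funext => x; ring.
Qed.

Lemma bp_bounded f : cl f -> exists M : R, forall x, `|f x| <= M.
Proof.
elim=> [{}f /Cbound//|a {}f g _ [M fM] _ [N gN]|u {}f M _ _ uM uf].
  exists (`|a| * M + N) => x; apply: le_trans (ler_normD _ _) _.
  by rewrite lerD// normrM ler_wpM2l.
exists M => x.
rewrite -(cvg_lim (@norm_hausdorff _ R^o) (cvg_norm (uf x))).
apply: limr_le.
  by apply/cvg_ex; eexists; apply: cvg_norm; exact: uf.
by apply: nearW => n; exact: uM.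
Qed.

(** Two successive inductions, first on the right factor with the left one in [C],
then on the left factor. *)
Lemma bpM f g : cl f -> cl g -> cl (fun x => f x * g x).
Proof.
have baseM h k : C h -> cl k -> cl (fun x => h x * k x).
  move=> Ch; have [M hM] := Cbound Ch.
  elim=> [{}k|a {}k l _ hk _ hl|u {}k N _ hu uN uk]; first exact: CM.
    by have := bp_lin a hk hl; congr bp_closure; apply/funext => x; ring.
  apply: (@bp_lim _ _ _ (fun n x => h x * u n x) _ (M * N)) => //.
    by move=> n x; rewrite normrM ler_pM.
  by move=> x; apply: cvgM; [exact: cvg_cst|exact: uk].
move=> + clg; have [N gN] := bp_bounded clg.
elim=> [{}f /baseM|a {}f h _ hf _ hh|u {}f M _ hu uM uf]; first exact.
  by have := bp_lin a hf hh; congr bp_closure; apply/funext => x; ring.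
apply: (@bp_lim _ _ _ (fun n x => u n x * g x) _ (M * N)) => //.
  by move=> n x; rewrite normrM ler_pM.
by move=> x; apply: cvgM; [exact: uf|exact: cvg_cst].
Qed.

Lemma bpX f n : cl f -> cl (fun x => f x ^+ n).
Proof.
move=> clf; elim: n => [|n IH].
  by under eq_fun do rewrite expr0; exact: bp_cst.
by under eq_fun do rewrite exprS; exact: bpM.
Qed.

Lemma bp_prod n (F : nat -> T -> R) : (forall i, cl (F i)) ->
  cl (fun x => \prod_(i < n) F i x).
Proof.
move=> clF; elim: n => [|n IH].
  by under eq_fun do rewrite big_ord0; exact: bp_cst.
by under eq_fun do rewrite big_ord_recr /=; exact: bpM.
Qed.

Lemma bp_indic_sigma : sigma_algebra [set: T] [set A | cl \1_A].
Proof.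
split => /=.
- by have := bp_zero; congr bp_closure; apply/funext => x; rewrite indic0.
- move=> A clA; have := bpB (bp_cst 1) clA.
  congr bp_closure; apply/funext => x.
  by rewrite !indicE setTD in_setC; case: (x \in A); rewrite ?subrr ?subr0.
- move=> A clA.
  pose u n x := 1 - \prod_(i < n) (1 - \1_(A i) x) : R.
  have clu n : cl (u n).
    apply: bpB; first exact: bp_cst.
    by apply: (@bp_prod n (fun i x => 1 - \1_(A i) x)) => i;
      apply: bpB; [exact: bp_cst|exact: clA].
  have u_in x i n : A i x -> (i < n)%N -> u n x = 1.
    move=> Aix ni; rewrite /u (bigD1 (Ordinal ni))//= indicE mem_set//.
    by rewrite subrr mul0r subr0.
  have u_out x n : (forall i, ~ A i x) -> u n x = 0.
    move=> nA; rewrite /u big1 ?subrr// => i _.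
    by rewrite indicE memNset// subr0.
  apply: (@bp_lim _ _ _ u _ 1) => // [n x|x].
    have [[i _ [Aix ni]]|nA] := pselect (exists2 i, True & A i x /\ (i < n)%N).
      by rewrite (u_in _ _ _ Aix ni) normr1.
    rewrite /u big1 ?subrr ?normr0// => i _.
    by rewrite indicE memNset ?subr0// => Aix; apply: nA; exists i.
  have [[i _ Aix]|nA] := pselect (exists2 i, True & A i x).
    rewrite indicE mem_set; last by exists i.
    apply: cvg_near_cst; exists i.+1 => //= n ni; exact: (u_in _ _ _ Aix).
  rewrite indicE memNset; last by move=> [i _ Aix]; apply: nA; exists i.
  by apply: cvg_near_cst; apply: nearW => n; apply: u_out => i Aix; apply: nA; exists i.
Qed.

End bp_closure.

(** * Half-lines as limits of trigonometric polynomials *)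

(** The functions of Brosowski and Deutsch in their proof of the Stone-Weierstrass
theorem: the [2 n]-th powers of the two sides of [g < 1/2] are separated by the
factor [4 ^ n], and the extra factor [n] settles the boundary case. *)
Lemma cvg_threshold (R : realType) (g : R) : 0 <= g <= 1 ->
  (1 - g ^+ (2 * n)) ^+ (n * 4 ^ n) @[n --> \oo] --> ((g < 2^-1)%R%:R : R).
Proof.
move=> /andP[g0 g1].
have cvg_inv (c : R) : 0 < c -> (1 + n%:R * c)^-1 @[n --> \oo] --> (0 : R).
  move=> c0; apply/gtr0_cvgV0.
    by apply: nearW => n; rewrite ltr_wpDr// mulr_ge0// ltW.
  apply/cvgryPge => A; near=> n.
  have : A / c <= n%:R by near: n; exact: nbhs_infty_ger.
  by rewrite ler_pdivrMr// => /le_trans; apply; rewrite lerDr.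
have expB (y : R) k : 0 <= y <= 1 -> (1 - y) ^+ k <= (1 + k%:R * y)^-1.
  move=> /andP[y0 y1].
  have : (1 - y) ^+ k <= expR (- (k%:R * y)).
    rewrite -mulrN expRM_natl.
    by rewrite lerXn2r ?nnegrE ?subr_ge0 ?expR_ge0// -[1 - y]/(1 + - y) expR_ge1Dx.
  move/le_trans; apply; rewrite expRN lef_pV2 ?posrE ?expR_gt0 ?expR_ge1Dx//.
  by rewrite ltr_wpDr// mulr_ge0.
have gn01 n : 0 <= g ^+ n <= 1 by rewrite exprn_ge0//= exprn_ile1.
have [gh|gh] := ltP g 2^-1; last first.
  apply: (@squeeze_cvgr _ _ _ _ (cst 0) (fun n : nat => (1 + n%:R * 1)^-1)) => //.
  - near=> n; apply/andP; split.
      by rewrite exprn_ge0// subr_ge0; case/andP: (gn01 (2 * n)%N).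
    apply: le_trans (expB _ _ (gn01 _)) _.
    have nn : (0 : R) <= n%:R by [].
    rewrite lef_pV2 ?posrE ?ltr_wpDr ?mulr_ge0//; last by case/andP: (gn01 (2*n)%N).
    rewrite lerD2l natrM -mulrA ler_wpM2l// natrX exprM -exprMn exprn_ege1//.
    nra.
  - exact: cvg_cst.
  - exact: cvg_inv.
rewrite -[X in _ --> X]subr0.
pose r := 2 * g.
have r0 : 0 <= r by rewrite /r mulr_ge0.
have r1 : r < 1 by rewrite /r; lra.
have main n : 0 <= 1 - (1 - g ^+ (2 * n)) ^+ (n * 4 ^ n) <= (1 - r)^-1 * r ^+ n.
  have /andP[y0 y1] := gn01 (2 * n)%N.
  rewrite subr_ge0 exprn_ile1 ?subr_ge0 ?gerBl//=.
  have bern k : 1 - k%:R * g ^+ (2 * n) <= (1 - g ^+ (2 * n)) ^+ k.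
    elim: k => [|k IH]; first by rewrite mul0r subr0 expr0.
    rewrite exprS; set y := g ^+ _ in y0 y1 IH *.
    apply: (@le_trans _ _ ((1 - y) * (1 - k%:R * y))); last first.
      by rewrite ler_wpM2l// subr_ge0.
    have : 0 <= k%:R * (y * y) by rewrite mulr_ge0// mulr_ge0.
    by rewrite -natr1; nra.
  rewrite lerBlDr addrC -lerBlDr; apply: le_trans (bern _).
  rewrite lerB// natrM natrX -mulrA exprM -exprMn.
  have -> : 4 * g ^+ 2 = r * r :> R by rewrite /r; ring.
  rewrite exprMn mulrA ler_wpM2r ?exprn_ge0//.
  rewrite -[leRHS]mul1r ler_pdivlMr ?subr_gt0//.
  have s0 : (0 : R) <= n%:R * (1 - r) by rewrite mulr_ge0// subr_ge0 ltW.
  have := expB (1 - r) n; rewrite subKr => /(_ _) h.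
  have {h} : r ^+ n <= (1 + n%:R * (1 - r))^-1 by apply: h; lra.
  move=> h; rewrite mulrAC; apply: le_trans (ler_wpM2l s0 h) _.
  by rewrite ler_pdivrMr ?ltr_wpDr// mul1r lerDr.
rewrite (_ : (fun n => _) = (fun n => 1 - (1 - (1 - g ^+ (2 * n)) ^+ (n * 4 ^ n)))); last first.
  by apply/funext => n; rewrite subKr.
apply: cvgB; first exact: cvg_cst.
apply: (@squeeze_cvgr _ _ _ _ (cst 0) (fun n : nat => (1 - r)^-1 * r ^+ n)).
- by near=> n; exact: main.
- exact: cvg_cst.
- rewrite -[X in _ --> X](mulr0 (1 - r)^-1); apply: cvgM; first exact: cvg_cst.
  by apply: cvg_expr; rewrite ger0_norm.
Unshelve. all: end_near. Qed.

Section trig_rays.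
Context (T : Type) (R : realType) (C : set (T -> R)).
Hypothesis Cone : C (fun=> 1).
Hypothesis Cbound : forall f, C f -> exists M : R, forall x, `|f x| <= M.
Hypothesis CM : forall f g, C f -> C g -> bp_closure C (fun x => f x * g x).
Local Notation cl := (bp_closure C).
Variable X : T -> R.
Hypothesis cosX : forall a, cl (fun w => cos (a * X w)).
Hypothesis sinX : forall a, cl (fun w => sin (a * X w)).

(** Applying [cvg_threshold] to [(1 + sin) / 2] detects the sign of a sine. *)
Lemma bp_half_period a x : cl (fun w => (sin (a * (X w - x)) < 0)%R%:R).
Proof.
pose g w := 2^-1 * (1 + sin (a * (X w - x))).
have clg : cl g.
  apply: bpZ => //; apply: bpD => //; first exact: bp_cst.
  have -> : (fun w => sin (a * (X w - x))) =
      (fun w => cos (a * x) * sin (a * X w) + - sin (a * x) * cos (a * X w)).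
    by apply/funext => w; rewrite mulrBr sinB; ring.
  by apply: bpD => //; apply: bpZ.
have g01 w : 0 <= g w <= 1.
  by have := sin_geN1 (a * (X w - x)); have := sin_le1 (a * (X w - x)); rewrite /g; lra.
apply: (@bp_lim _ _ _ (fun n w => (1 - g w ^+ (2 * n)) ^+ (n * 4 ^ n)) _ 1).
- move=> n; apply: (@bpX _ _ _ _ _ _ (fun w => 1 - g w ^+ (2 * n))) => //.
  by apply: bpB => //; [exact: bp_cst|exact: bpX].
- move=> n w; have /andP[g0 g1] := g01 w.
  have gn : 0 <= 1 - g w ^+ (2 * n) <= 1 by rewrite subr_ge0 exprn_ile1//= gerBl exprn_ge0.
  case/andP: gn => gn0 gn1.
  by rewrite ger0_norm ?exprn_ge0// exprn_ile1.
- move=> w; have := cvg_threshold (g01 w).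
  have -> : (g w < 2^-1) = (sin (a * (X w - x)) < 0) by rewrite /g; apply/idP/idP; lra.
  by [].
Qed.

(** As the period grows, the half-period of the sine below [x] exhausts the
half-line. *)
Lemma bp_ray x : cl \1_[set w | X w < x].
Proof.
apply: (@bp_lim _ _ _ (fun n w => (sin (n.+1%:R^-1 * (X w - x)) < 0)%R%:R) _ 1).
- by move=> n; exact: bp_half_period.
- by move=> n w; case: (_ < 0); rewrite ?normr1 ?normr0.
move=> w; apply: cvg_near_cst.
near=> n.
have npi : `|X w - x| < pi * n.+1%:R.
  rewrite mulrC -ltr_pdivrMr ?pi_gt0//.
  have : `|X w - x| / pi < n%:R by near: n; exact: nbhs_infty_gtr.
  by move/lt_trans; apply; rewrite ltr_nat.
have n0 : (0 : R) < n.+1%:R by [].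
rewrite indicE (_ : (w \in _) = (X w < x)); last by apply/idP/idP; rewrite inE.
congr (nat_of_bool _)%:R.
have [Xx|Xx|Xx] := ltgtP (X w) x.
- rewrite -[_ * _]opprK sinN oppr_lt0; apply: sin_gt0_pi.
  rewrite -mulrN opprB mulr_gt0 ?invr_gt0 ?subr_gt0//=.
  by rewrite mulrC ltr_pdivrMr// -(@gtr0_norm _ (x - X w)) ?subr_gt0// distrC.
- apply/negbTE; rewrite -leNgt ltW//; apply: sin_gt0_pi.
  rewrite mulr_gt0 ?invr_gt0 ?subr_gt0//=.
  by rewrite mulrC ltr_pdivrMr// -(@gtr0_norm _ (X w - x)) ?subr_gt0.
- by rewrite Xx subrr mulr0 sin0 ltxx.
Unshelve. all: end_near. Qed.

Lemma bp_preimage B : measurable B -> cl \1_(X @^-1` B).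
Proof.
have S : sigma_algebra [set: R] [set B | cl \1_(X @^-1` B)].
  have [S0 SC SU] := bp_indic_sigma Cone Cbound CM.
  split => /=.
  - by rewrite preimage_set0.
  - by move=> A /SC /=; rewrite !setTD preimage_setC.
  - by move=> F /SU /=; rewrite preimage_bigcup.
have -> : measurable B = (@RGenInftyO.G R).-sigma.-measurable B.
  by rewrite -RGenInftyO.measurableE.
apply: (smallest_sub S) => _ [x ->] /=.
have := bp_ray x; congr bp_closure; congr indic.
Qed.

End trig_rays.

(** * Weights orthogonal to a sigma-algebra *)

Section orthogonality.
Context d (T : measurableType d) (R : realType).
Variable P : probability T R.
Local Notation E f := (Rintegral P [set: T] f).

Lemma integrable_bmeasM f g : bmeas f -> P.-integrable [set: T] (EFin \o g) ->
  P.-integrable [set: T] (EFin \o (fun w => f w * g w)).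
Proof.
move=> [mf [M fM]] ig.
have mg : measurable_fun [set: T] g.
  by have /integrableP[/measurable_EFinP] := ig.
have iMg : P.-integrable [set: T] (EFin \o (fun w => M * g w)).
  rewrite (_ : _ \o _ = (fun w => M%:E * (EFin \o g) w)%E); last first.
    by apply/funext => w.
  exact: integrableZl.
apply: le_integrable iMg => //.
  by apply/measurable_EFinP; exact: measurable_funM.
move=> w _ /=; rewrite lee_fin !normrM ler_wpM2r//.
exact: le_trans (fM w) (ler_norm _).
Qed.

Lemma bp_closure_meas C f : (forall h, C h -> measurable_fun [set: T] h) ->
  bp_closure C f -> measurable_fun [set: T] (f : T -> R).
Proof.
move=> mC; elim=> [{}f /mC//|a {}f h _ mf _ mh|u {}f M _ mu uM uf].
  by apply: measurable_funD => //; exact: measurable_funM.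
exact: (measurable_fun_cvg mu (fun x _ => uf x)).
Qed.

Lemma bp_closure_orth C g f : (forall h, C h -> bmeas h) ->
  P.-integrable [set: T] (EFin \o g) ->
  (forall h, C h -> E (fun w => h w * g w) = 0) ->
  bp_closure C f -> E (fun w => f w * g w) = 0.
Proof.
move=> bC ig orthC.
have mg : measurable_fun [set: T] g.
  by have /integrableP[/measurable_EFinP] := ig.
have mcl h : bp_closure C h -> bmeas h.
  move=> clh; split; first by apply: bp_closure_meas clh => k /bC[].
  by apply: bp_bounded clh => k /bC[].
elim=> [{}f /orthC//|a {}f h clf Ef clh Eh|u {}f M clu Eu uM uf].
  transitivity (E (fun w => a * (f w * g w) + h w * g w)).
    by apply: eq_Rintegral => w _; rewrite mulrDl mulrA.
  have ifg := integrable_bmeasM (mcl _ clf) ig.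
  have ihg := integrable_bmeasM (mcl _ clh) ig.
  have iafg : P.-integrable [set: T] (EFin \o (fun w => a * (f w * g w))).
    rewrite (_ : _ \o _ = (fun w => a%:E * (EFin \o (fun w => (f w * g w)%R)) w)%E).
      exact: integrableZl.
    by apply/funext.
  by rewrite RintegralD// RintegralZl// Ef Eh mulr0 addr0.
have clf : bp_closure C f by exact: bp_lim uM uf.
have cv : E (fun w => u n w * g w) @[n --> \oo] --> E (fun w => f w * g w).
  apply: (@dominated_cvg_Rintegral _ _ _ _ _ _ (fun w => `|M| * `|g w|)).
  - by move=> n; apply: measurable_funM => //; case: (mcl _ (clu n)).
  - by apply: measurable_funM => //; case: (mcl _ clf).
  - rewrite (_ : _ \o _ = (fun w => `|M|%:E * (EFin \o (Num.norm \o g)) w)%E); last first.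
      by apply/funext.
    apply: integrableZl => //; exact: integrable_norm.
  - move=> n w; rewrite normrM ler_wpM2r//.
    exact: le_trans (uM n w) (ler_norm _).
  - by apply: aeW => w; apply: cvgM; [exact: uf|exact: cvg_cst].
rewrite -(cvg_lim (@norm_hausdorff _ R^o) cv).
under eq_fun do rewrite Eu.
exact: lim_cst.
Qed.

Definition linear_family (S : set (T -> R)) : Prop :=
  S (fun=> 0) /\ forall a X Y, S X -> S Y -> S (fun w => a * X w + Y w).

(** Uniqueness of the Fourier transform for signed measures with a density [g].
The product formulas make the span of the sines and cosines an algebra, so the sets
whose indicator is a bounded limit of that algebra form a sigma-algebra, and it
contains the half-lines of every [X u]. *)
Lemma trig_orthogonal S g (J : set R) (X : R -> T -> R) A : linear_family S ->
  (forall Y, S Y -> measurable_fun [set: T] Y) ->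
  P.-integrable [set: T] (EFin \o g) ->
  (forall Y, S Y -> E (fun w => cos (Y w) * g w) = 0) ->
  (forall Y, S Y -> E (fun w => sin (Y w) * g w) = 0) ->
  (forall u, J u -> S (X u)) ->
  sigma_generated J X A -> E (fun w => \1_A w * g w) = 0.
Proof.
move=> [S0 Slin] mS ig cosg sing JS.
pose C : set (T -> R) :=
  [set f | exists2 Y, S Y & f = (fun w => cos (Y w)) \/ f = (fun w => sin (Y w))].
have Ccos Y : S Y -> C (fun w => cos (Y w)) by move=> SY; exists Y => //; left.
have Csin Y : S Y -> C (fun w => sin (Y w)) by move=> SY; exists Y => //; right.
have bC h : C h -> bmeas h.
  by case=> Y /mS mY [] ->; [exact: bmeas_cos|exact: bmeas_sin].
have SZ a Y : S Y -> S (fun w => a * Y w).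
  by move=> SY; have := Slin a _ _ SY S0; congr S; apply/funext => w; rewrite addr0.
have SD Y Z : S Y -> S Z -> S (fun w => Y w + Z w).
  by move=> SY SZ'; have := Slin 1 _ _ SY SZ'; congr S; apply/funext => w; rewrite mul1r.
have SB Y Z : S Y -> S Z -> S (fun w => Y w - Z w).
  by move=> SY SZ'; have := Slin (-1) _ _ SZ' SY; congr S; apply/funext => w; ring.
have Cone : C (fun=> 1).
  by exists (fun=> 0) => //; left; apply/funext => w; rewrite cos0.
have Cbound f : C f -> exists M : R, forall x, `|f x| <= M by move=> /bC[].
have half f h k : C f -> C h -> (forall w, k w = 2^-1 * f w + 2^-1 * h w) ->
    bp_closure C k.
  move=> Cf Ch kE; have -> : k = (fun w => 2^-1 * f w + 2^-1 * h w) by exact/funext.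
  by apply: bpD => //; apply: bpZ => //; exact: bp_base.
have CM f h : C f -> C h -> bp_closure C (fun x => f x * h x).
  move=> [Y SY fY] [Z SZ' hZ].
  case: fY => ->; case: hZ => ->.
  - apply: (half _ _ _ (Ccos _ (SD _ _ SY SZ')) (Ccos _ (SB _ _ SY SZ'))) => w.
    by rewrite cosB cosD; field.
  - apply: (half _ (fun w => sin (Z w - Y w)) _ (Csin _ (SD _ _ SY SZ'))) => [|w].
      exact: (Csin _ (SB _ _ SZ' SY)).
    by rewrite sinB sinD; field.
  - apply: (half _ _ _ (Csin _ (SD _ _ SY SZ')) (Csin _ (SB _ _ SY SZ'))) => w.
    by rewrite sinB sinD; field.
  - have -> : (fun w => sin (Y w) * sin (Z w)) =
        (fun w => 2^-1 * cos (Y w - Z w) + - 2^-1 * cos (Y w + Z w)).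
      by apply/funext => w; rewrite cosB cosD; field.
    by apply: bpD => //; apply: bpZ => //; apply: bp_base; apply: Ccos; [exact: SB|exact: SD].
move=> sA; apply: (bp_closure_orth bC ig) => [h [Y SY [] ->]|]; [exact: cosg|exact: sing|].
apply: (smallest_sub (bp_indic_sigma Cone Cbound CM)) sA => B [u Ju [D mD <-]].
rewrite setTI /=; apply: bp_preimage => // a; apply: bp_base.
- by apply: (Ccos (fun w => a * X u w)); apply: SZ; exact: JS.
- by apply: (Csin (fun w => a * X u w)); apply: SZ; exact: JS.
Qed.

(** From events to functions: a bounded [Y] is a uniform limit of its roundings to
multiples of [1 / (n + 1)], each of which is a sum of indicators of superlevel sets; an
unbounded [Y] is truncated first. *)
Lemma sigma_orthogonal (G : set (set T)) g (Y : T -> R) :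
  sigma_algebra [set: T] G -> G `<=` measurable ->
  P.-integrable [set: T] (EFin \o g) ->
  (forall A, G A -> E (fun w => \1_A w * g w) = 0) ->
  (forall B, measurable B -> G (Y @^-1` B)) ->
  P.-integrable [set: T] (EFin \o (fun w => Y w * g w)) ->
  E (fun w => Y w * g w) = 0.
Proof.
move=> sG Gm ig gG mY iYg.
pose C : set (T -> R) := [set f | exists2 A, G A & f = \1_A].
have [G0 GC GU] := sG.
have GT : G [set: T] by have := GC _ G0; rewrite setD0.
have GI A B : G A -> G B -> G (A `&` B).
  move=> GA GB; pose F i := if i is 0%N then ~` A else ~` B.
  have := GU F; have -> : A `&` B = [set: T] `\` \bigcup_i F i.
    rewrite setTD; apply/seteqP; split => [w [Aw Bw] [[|i] _]//|w nF].
    split; apply: contrapT => nw; apply: nF; [by exists 0%N|by exists 1%N].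
  move=> GF; apply: (GC); apply: GF => -[|i] /=; rewrite -setTD; exact: GC.
have bC h : C h -> bmeas h by case=> A /Gm mA ->; exact: bmeas_indic.
have Cone : C (fun=> 1).
  by exists [set: T] => //; apply/funext => w; rewrite indicT.
have Cbound f : C f -> exists M : R, forall x, `|f x| <= M by move=> /bC[].
have CM f h : C f -> C h -> bp_closure C (fun x => f x * h x).
  move=> [A GA ->] [B GB ->]; apply: bp_base; exists (A `&` B); first exact: GI.
  by apply/funext => w; rewrite indicI.
(* rounding [Z] down to a multiple of [1 / (n + 1)] counts the levels below [Z] *)
have clB (Z : T -> R) : (forall B : set R, measurable B -> G (Z @^-1` B)) ->
    forall M, (forall w, 0 <= Z w <= M) -> bp_closure C Z.
  move=> mZ M ZM.
  have nZ0 n w : 0 <= n.+1%:R * Z w by rewrite mulr_ge0//; case/andP: (ZM w).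
  apply: (@bp_lim _ _ _ (fun n w => n.+1%:R^-1 * (Num.truncn (n.+1%:R * Z w))%:R) _ M).
  - move=> n; apply: bpZ => //.
    pose N := Num.bound (n.+1%:R * `|M|).
    have tN w : (Num.truncn (n.+1%:R * Z w) <= N)%N.
      rewrite -(ler_nat R); apply: le_trans (_ : n.+1%:R * Z w <= _).
        by rewrite truncn_le.
      apply: le_trans (ltW (archi_boundP (_ : 0 <= n.+1%:R * `|M|))); last first.
        by rewrite mulr_ge0.
      rewrite ler_wpM2l//; case/andP: (ZM w) => _ /le_trans; apply.
      exact: ler_norm.
    have -> : (fun w => (Num.truncn (n.+1%:R * Z w))%:R) =
        (fun w => \sum_(k < N) \1_(Z @^-1` `[k.+1%:R / n.+1%:R, +oo[) w) :> (T -> R).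
      apply/funext => w; move: (tN w); set m := Num.truncn _ => mN.
      rewrite (_ : m = \sum_(k < N) (k < m)%N)%N; last first.
        elim: {tN} N mN => [|N' IH]; first by rewrite leqn0 big_ord0 => /eqP.
        rewrite leq_eqVlt big_ord_recr /= => /orP[/eqP mN|].
          rewrite mN ltnSn (eq_bigr (fun=> 1%N)); first by rewrite sum1_card card_ord addn1.
          by move=> i _; rewrite (ltn_trans (ltn_ord i)).
        by rewrite ltnS => mN; rewrite ltnNge mN addn0; exact: IH.
      rewrite natr_sum; apply: eq_bigr => k _.
      rewrite /m truncn_gt_nat indicE; congr (nat_of_bool _)%:R.
      rewrite -ler_pdivrMl// mulrC.
      by apply/idP/idP; rewrite inE/= in_itv/= andbT.
    elim: N {tN} => [|N IH].
      by under eq_fun do rewrite big_ord0; exact: bp_zero.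
    under eq_fun do rewrite big_ord_recr /=.
    apply: bpD => //; apply: bp_base.
    exists (Z @^-1` `[N.+1%:R / n.+1%:R, +oo[) => //.
    by apply: mZ; exact: measurable_itv.
  - move=> n w; have /andP[Z0 ZMw] := ZM w.
    rewrite ger0_norm ?mulr_ge0//; apply: le_trans ZMw.
    by rewrite ler_pdivrMl// truncn_le.
  - move=> w; apply: (@squeeze_cvgr _ _ _ _ (fun n : nat => Z w - n.+1%:R^-1) (cst (Z w))).
    + apply: nearW => n; have /andP[h1 h2] := truncn_itv (nZ0 n w).
      rewrite ler_pdivrMl// h1 andbT ler_pdivlMl// mulrBr divff//.
      by rewrite lerBlDr natr1 ltW.
    + rewrite -[X in _ --> X]subr0; apply: cvgB; first exact: cvg_cst.
      exact: cvg_harmonic.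
    + exact: cvg_cst.
have mB (B : set R) : measurable B -> measurable (Y @^-1` B) by move=> /mY /Gm.
have mYf : measurable_fun [set: T] Y by move=> _ B mb; rewrite setTI; exact: mB.
have mg : measurable_fun [set: T] g.
  by have /integrableP[/measurable_EFinP] := ig.
pose D n : set R := `[- n%:R, n%:R]%classic.
pose Yn n w := Y w * \1_(Y @^-1` D n) w.
have clYn n : bp_closure C (Yn n).
  have -> : Yn n = (fun w => (Yn n w + n%:R) + - n%:R) by apply/funext => w; ring.
  apply: bpD => //; last exact: bp_cst.
  apply: (clB _ _ (2 * n%:R)) => [B mb|w].
    rewrite (_ : _ @^-1` B = Y @^-1` ((fun y => y * \1_(D n) y + n%:R) @^-1` B))//.
    apply: mY; rewrite -[_ @^-1` _]setTI.
    have : measurable_fun [set: R] (fun y => y * \1_(D n) y + n%:R).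
      apply: measurable_funD => //; apply: measurable_funM => //.
      by apply: measurable_indic; exact: measurable_itv.
    exact.
  rewrite /Yn indicE.
  case: (boolP (w \in _)); rewrite ?inE/= ?in_itv/=.
    move=> /andP[+ +]; rewrite !bnd_simp mulr1 => h1 h2; lra.
  by move=> _; rewrite mulr0 add0r; have : (0 : R) <= n%:R by []; lra.
have EYn n : E (fun w => Yn n w * g w) = 0.
  apply: (bp_closure_orth bC ig) (clYn n) => h [A GA ->]; exact: gG.
have cv : E (fun w => Yn n w * g w) @[n --> \oo] --> E (fun w => Y w * g w).
  apply: (@dominated_cvg_Rintegral _ _ _ _ _ _ (fun w => `|Y w * g w|)).
  - move=> n; apply: measurable_funM => //; apply: measurable_funM => //.
    by apply: measurable_indic; apply: mB; exact: measurable_itv.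
  - exact: measurable_funM.
  - exact: integrable_norm.
  - move=> n w; rewrite /Yn !normrM mulrAC ler_piMr ?mulr_ge0//.
    by rewrite indicE; case: (_ \in _); rewrite ?normr0 ?normr1.
  - apply: aeW => w; apply: cvgM; last exact: cvg_cst.
    apply: cvg_near_cst; near=> n.
    rewrite /Yn indicE mem_set ?mulr1// /preimage /= /D /= in_itv /= -ler_norml.
    by near: n; exact: nbhs_infty_ger.
rewrite -(cvg_lim (@norm_hausdorff _ R^o) cv).
under eq_fun do rewrite EYn.
exact: lim_cst.
Unshelve. all: end_near. Qed.

End orthogonality.

(** * The characteristic function of the normal law *)

Section total_derivative.
Context (R : realType).
Local Notation mu := (@lebesgue_measure R).

(** Integration by parts on the whole line, in the form used to set up the
differential equation of the characteristic function. *)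
Lemma Rintegral_total_derivative (H h : R -> R) :
  continuous h -> (forall x : R, is_derive x 1 H (h x)) ->
  mu.-integrable [set: R] (EFin \o h) ->
  H n%:R @[n --> \oo] --> (0 : R) -> H (- n%:R) @[n --> \oo] --> (0 : R) ->
  \int[mu]_x h x = 0.
Proof.
move=> ch dH ih Hp Hn.
have mh : measurable_fun [set: R] h by exact: continuous_measurable_fun.
pose D n : set R := `[- n%:R, n%:R]%classic.
have cv : \int[mu]_x (h x * \1_(D n) x) @[n --> \oo] --> \int[mu]_x h x.
  apply: (@dominated_cvg_Rintegral _ _ _ mu (fun n x => h x * \1_(D n) x) h (fun w => `|h w|)).
  - move=> n; apply: measurable_funM => //.
    by apply: measurable_indic; exact: measurable_itv.
  - by [].
  - exact: integrable_norm.
  - move=> n w; rewrite normrM ler_piMr//.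
    by rewrite indicE; case: (_ \in _); rewrite ?normr0 ?normr1.
  - apply: aeW => w; apply: cvg_near_cst; near=> n.
    rewrite indicE mem_set ?mulr1// /D /= in_itv /= -ler_norml.
    by near: n; exact: nbhs_infty_ger.
have E n : \int[mu]_x (h x * \1_(D n.+1) x) = H n.+1%:R - H (- n.+1%:R).
  rewrite -[RHS]/(fine (H n.+1%:R - H (- n.+1%:R))%:E) EFinB.
  rewrite -(@continuous_FTC2 _ h H (- n.+1%:R) n.+1%:R); first last.
  - by move=> x _; rewrite derive1E; exact: derive_val.
  - have cH : continuous H.
      by move=> x; apply: differentiable_continuous; exact/derivable1_diffP.
    split; first by move=> x _.
    + by apply: cvg_at_right_filter; exact: cH.
    + by apply: cvg_at_left_filter; exact: cH.
  - exact: continuous_subspaceT.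
  - by rewrite gtrN.
  rewrite /Rintegral [in RHS]integral_mkcond; congr fine; apply: eq_integral => x _.
  by rewrite patchE indicE; case: (_ \in _); rewrite ?mulr1 ?mulr0.
rewrite -(cvg_lim (@norm_hausdorff _ R^o) cv).
have cv0 : H n.+1%:R - H (- n.+1%:R) @[n --> \oo] --> (0 - 0 : R).
  apply: cvgB; first by rewrite (cvg_shiftS (fun n => H n%:R)).
  by rewrite (cvg_shiftS (fun n => H (- n%:R))).
apply: cvg_lim => //; rewrite -cvg_shiftS.
by under eq_fun do rewrite E; rewrite subr0 in cv0.
Unshelve. all: end_near. Qed.

End total_derivative.

Section gauss_transform.
Context (R : realType).
Local Notation mu := (@lebesgue_measure R).
Variables (m k : R).
Hypothesis k0 : 0 < k.

(** The normal density with variance [1 / (2 * k)], up to normalization. *)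
Definition bell (m k x : R) : R := expR (- (k * (x - m) ^+ 2)).

Lemma bell_ge0 j x : 0 <= bell m j x. Proof. exact: expR_ge0. Qed.

Lemma continuous_bell j : continuous (bell m j).
Proof.
move=> x; apply: continuous_comp; last exact: continuous_expR.
apply: cvgN; apply: cvgM; first exact: cvg_cst.
apply: (@continuous_comp _ _ _ (fun x => x - m) (fun x => x ^+ 2)).
  by apply: cvgB; [exact: cvg_id|exact: cvg_cst].
exact: exprn_continuous.
Qed.

Lemma integrable_bell j : 0 < j -> mu.-integrable [set: R] (EFin \o bell m j).
Proof.
move=> j0; pose s := Num.sqrt (2 * j)^-1.
have s2 : s ^+ 2 = (2 * j)^-1 by rewrite sqr_sqrtr// invr_ge0 mulr_ge0// ltW.
have s0 : s != 0 by rewrite gt_eqF// sqrtr_gt0 invr_gt0 mulr_gt0.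
have := @integrable_normal_pdf R m s.
move/(integrableZl measurableT (normal_peak s)^-1).
apply: eq_integrable => // x _ /=; rewrite normal_pdfE// -EFinM.
rewrite mulrA mulVf ?gt_eqF ?normal_peak_gt0// mul1r /normal_fun s2 /bell.
congr (expR _)%:E; rewrite -mulr_natl; field.
by rewrite gt_eqF.
Qed.

(** Half of the exponent pays for the linear factor. *)
Lemma normM_bell x : `|x - m| * bell m k x <= (1 + 2 / k) * bell m (k / 2) x.
Proof.
set y := x - m.
have -> : bell m k x = bell m (k / 2) x * bell m (k / 2) x.
  by rewrite /bell -expRD; congr expR; field.
rewrite mulrA ler_wpM2r ?bell_ge0//.
have h : 1 + k / 2 * y ^+ 2 <= (bell m (k / 2) x)^-1.
  by rewrite /bell -expRN opprK expR_ge1Dx.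
rewrite -ler_pdivlMr ?expR_gt0//.
apply: (@le_trans _ _ ((1 + 2 / k) * (1 + k / 2 * y ^+ 2))); last first.
  by rewrite ler_wpM2l// addr_ge0// divr_ge0// ltW.
have -> : (1 + 2 / k) * (1 + k / 2 * y ^+ 2) =
    1 + `|y| ^+ 2 + 2 / k + k / 2 * y ^+ 2.
  by rewrite real_normK ?num_real//; field; rewrite gt_eqF.
have t1 : 0 <= 2 / k by rewrite divr_ge0// ltW.
have t2 : 0 <= k / 2 * y ^+ 2 by rewrite mulr_ge0 ?sqr_ge0// divr_ge0// ltW.
have := normr_ge0 y; nra.
Qed.

Lemma integrable_normM_bell :
  mu.-integrable [set: R] (EFin \o (fun x => `|x - m| * bell m k x)).
Proof.
have := integrable_bell (_ : 0 < k / 2); rewrite divr_gt0// => /(_ isT).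
move/(integrableZl measurableT (1 + 2 / k)).
apply: le_integrable => //.
  apply/measurable_EFinP; apply: measurable_funM.
    by apply: measurableT_comp => //; exact: measurable_funB.
  by apply: continuous_measurable_fun; exact: continuous_bell.
move=> x _ /=; have K0 : 0 <= 1 + 2 / k by rewrite addr_ge0// divr_ge0// ltW.
rewrite lee_fin normrM normr_id (ger0_norm (bell_ge0 _ _)) [leRHS]ger0_norm ?normM_bell//.
by rewrite mulr_ge0 ?bell_ge0.
Qed.

Lemma bell_cvg0 (u : nat -> R) : (forall n, n%:R - `|m| <= `|u n - m|) ->
  bell m k (u n) @[n --> \oo] --> (0 : R).
Proof.
move=> un; pose K := 1 + 2 / k.
have K0 : 0 <= K by rewrite addr_ge0// divr_ge0// ltW.
have b1 x : bell m (k / 2) x <= 1.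
  by rewrite -expR0 ler_expR oppr_le0 mulr_ge0 ?sqr_ge0// divr_ge0// ltW.
apply/cvgrPdist_le => e e0; near=> n.
rewrite sub0r normrN ger0_norm ?bell_ge0//.
have h : `|m| + 1 + K / e <= n%:R by near: n; exact: nbhs_infty_ger.
have Ke : 0 <= K / e by rewrite divr_ge0// ltW.
have unn : K / e <= `|u n - m| by have := un n; lra.
have u0 : 0 < `|u n - m| by have := un n; lra.
have := normM_bell (u n); have := b1 (u n); rewrite -/K => b1n nb.
have : `|u n - m| * bell m k (u n) <= K.
  by apply: le_trans nb _; rewrite ler_piMr.
rewrite mulrC -ler_pdivlMr// => /le_trans; apply.
rewrite ler_pdivrMr//; move: unn; rewrite ler_pdivrMr// mulrC; exact.
Unshelve. all: end_near. Qed.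

Lemma is_derive_affine (a x : R) : is_derive x (1 : R) (fun x : R => a * (x - m)) a.
Proof.
have -> : (fun x => a * (x - m)) = a *: (id - cst m) :> (R -> R) by [].
by apply: trigger_derive; rewrite subr0 /GRing.scale/= mulr1.
Qed.

Lemma is_derive_bell (x : R) : is_derive x (1 : R) (bell m k) (- (2 * k * (x - m)) * bell m k x).
Proof.
have d : is_derive x (1 : R) (fun x : R => - (k * (x - m) ^+ 2)) (- (2 * k * (x - m))).
  have -> : (fun x => - (k * (x - m) ^+ 2)) = (- k) *: ((id - cst m) ^+ 2) :> (R -> R).
    by apply/funext => y; exact: (esym (mulNr _ _)).
  apply: trigger_derive; rewrite subr0 /GRing.scale/= expr1 !fctE.
  by rewrite mulr1 mulNr mulrA (mulrC k).
have := @is_derive1_comp _ expR (fun x => - (k * (x - m) ^+ 2)) x _ _ (is_derive_expR _) d.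
by rewrite mulrC.
Qed.

End gauss_transform.

Lemma cvg0_le (R : realType) (u v : nat -> R) : (forall n, `|u n| <= v n) ->
  v n @[n --> \oo] --> (0 : R) -> u n @[n --> \oo] --> (0 : R).
Proof.
move=> uv v0; apply: norm_cvg0.
apply: (@squeeze_cvgr _ _ _ _ (cst 0) v) => //; last exact: cvg_cst.
by apply: nearW => n; rewrite normr_ge0 uv.
Qed.

Section gauss_fourier.
Context (R : realType).
Local Notation mu := (@lebesgue_measure R).
Variables (m k c : R).
Hypothesis k0 : 0 < k.

Local Notation bell := (bell m k).
Let f (a x : R) : R := cos (a * (x - m) + c) * bell x.
Let F (a : R) : R := \int[mu]_x f a x.

Let mbell : measurable_fun [set: R] bell.
Proof. by apply: continuous_measurable_fun; exact: continuous_bell. Qed.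

Let cphase (a : R) : continuous (fun x : R => a * (x - m) + c).
Proof.
move=> x; apply: cvgD; last exact: cvg_cst.
apply: cvgM; first exact: cvg_cst.
by apply: cvgB; [exact: cvg_id|exact: cvg_cst].
Qed.

Let ccos (a : R) : continuous (fun x : R => cos (a * (x - m) + c)).
Proof. by move=> x; apply: continuous_comp; [exact: cphase|exact: continuous_cos]. Qed.

Let csin (a : R) : continuous (fun x : R => sin (a * (x - m) + c)).
Proof. by move=> x; apply: continuous_comp; [exact: cphase|exact: continuous_sin]. Qed.

Let intf a : mu.-integrable [set: R] (EFin \o f a).
Proof.
apply: le_integrable (integrable_bell m k0) => //.
  apply/measurable_EFinP; apply: measurable_funM => //.
  exact: (continuous_measurable_fun (@ccos a)).
move=> x _; rewrite /= lee_fin normrM ler_piMl ?normr_ge0//; exact: cos_max.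
Qed.

Let ints a : mu.-integrable [set: R]
  (EFin \o (fun x => (x - m) * sin (a * (x - m) + c) * bell x)).
Proof.
apply: le_integrable (integrable_normM_bell m k0) => //.
  apply/measurable_EFinP; apply: measurable_funM => //; apply: measurable_funM.
    exact: measurable_funB.
  exact: continuous_measurable_fun (@csin a).
move=> x _; rewrite /= lee_fin !normrM normr_id ler_wpM2r ?normr_ge0//.
by rewrite ler_piMr ?normr_ge0//; exact: sin_max.
Qed.

Let dphase (a x : R) : is_derive a (1 : R) (fun a : R => a * (x - m) + c) (x - m).
Proof.
have -> : (fun a => a * (x - m) + c) = (x - m) *: id + cst c :> (R -> R).
  by apply/funext => b; rewrite [RHS]/(_ * _ + _) mulrC.
by apply: trigger_derive; rewrite addr0 /GRing.scale/= mulr1.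
Qed.

Let df (a x : R) : is_derive a (1 : R) (f ^~ x) (- ((x - m) * sin (a * (x - m) + c) * bell x)).
Proof.
have d := @is_derive1_comp _ cos (fun a => a * (x - m) + c) a _ _ (is_derive_cos _) (dphase a x).
have -> : f ^~ x = bell x *: (cos \o (fun a => a * (x - m) + c)) :> (R -> R).
  by apply/funext => b; rewrite /f mulrC.
apply: trigger_derive; rewrite /GRing.scale/=.
by rewrite mulNr mulrN mulrC (mulrC (sin _)).
Qed.

Let dF (a : R) : is_derive a (1 : R) F
  (- \int[mu]_x ((x - m) * sin (a * (x - m) + c) * bell x)).
Proof.
have aI : [set` `]a - 1, a + 1[] a by rewrite /= in_itv /=; apply/andP; split; lra.
have d1E x y : partial1of2 f x y = - ((y - m) * sin (x * (y - m) + c) * bell y).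
  by rewrite partial1of2E; exact: (@derive_val _ _ _ _ _ _ _ (df x y)).
have Gub x y : [set` `]a - 1, a + 1[] x -> [set: R] y ->
    `|partial1of2 f x y| <= `|y - m| * bell y.
  move=> _ _; rewrite d1E normrN !normrM (ger0_norm (bell_ge0 _ _ _)).
  rewrite ler_wpM2r ?bell_ge0//.
  by rewrite ler_piMr ?normr_ge0//; exact: sin_max.
have der x y : [set` `]a - 1, a + 1[] x -> [set: R] y -> derivable (f ^~ y) x 1.
  by move=> _ _; exact: (@ex_derive _ _ _ _ _ _ _ (df x y)).
have intG := integrable_normM_bell m k0.
have G0 y : 0 <= `|y - m| * bell y by rewrite mulr_ge0 ?bell_ge0.
apply: DeriveDef.
  exact: (derivable_under_integral measurableT aI (fun x _ => intf x) der G0 intG Gub).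
rewrite -derive1E.
rewrite (differentiation_under_integral measurableT aI (fun x _ => intf x) der G0 intG Gub).
under eq_Rintegral do rewrite d1E -mulN1r.
by rewrite RintegralZl// mulN1r.
Qed.

(* integrating the derivative of [sin (a * (x - m) + c) * bell x] turns [F'] into a
   multiple of [F] *)
Let ode a : is_derive a (1 : R) F (- (a / (2 * k)) * F a).
Proof.
suff E : \int[mu]_x (a * f a x - 2 * k * ((x - m) * sin (a * (x - m) + c) * bell x)) = 0.
  have i1 : mu.-integrable [set: R] (EFin \o (fun x => a * f a x)).
    rewrite (_ : _ \o _ = (fun w => a%:E * (EFin \o f a) w)%E); last by apply/funext.
    exact: integrableZl.
  have i2 : mu.-integrable [set: R]
      (EFin \o (fun x => 2 * k * ((x - m) * sin (a * (x - m) + c) * bell x))).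
    rewrite (_ : _ \o _ = (fun w => (2 * k)%:E *
      (EFin \o (fun x => ((x - m) * sin (a * (x - m) + c) * bell x)%R)) w)%E); last by apply/funext.
    exact: integrableZl.
  move: E; rewrite RintegralB// !RintegralZl// => E.
  apply: is_derive_eq (dF a) _.
  have k2 : 2 * k != 0 by rewrite mulf_neq0// gt_eqF.
  apply: (mulfI k2); rewrite -/(F a) in E *.
  move: E; move: (Rintegral _ _ _) => z E.
  have -> : 2 * k * (- (a / (2 * k)) * F a) = - (a * F a) by field; rewrite gt_eqF.
  by lra.
apply: (@Rintegral_total_derivative _ (fun x => sin (a * (x - m) + c) * bell x)).
- move=> x; apply: cvgB.
    apply: cvgM; first exact: cvg_cst.
    by apply: cvgM; [exact: ccos|exact: continuous_bell].
  apply: cvgM; first exact: cvg_cst.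
  apply: cvgM; last exact: continuous_bell.
  apply: cvgM; last exact: csin.
  by apply: cvgB; [exact: cvg_id|exact: cvg_cst].
- move=> x.
  have dp : is_derive x (1 : R) (fun x : R => a * (x - m) + c) a.
    have h := is_derive_affine m a x.
    have -> : (fun x => a * (x - m) + c) = (fun x => a * (x - m)) + cst c :> (R -> R) by [].
    by apply: trigger_derive; rewrite addr0.
  have ds := @is_derive1_comp _ sin _ x _ _ (is_derive_sin _) dp.
  have db := is_derive_bell m k x.
  apply: (trigger_derive (is_deriveM ds db)).
  by rewrite /f /GRing.scale/=; ring.
- have i1 : mu.-integrable [set: R] (EFin \o (fun x => a * f a x)).
    rewrite (_ : _ \o _ = (fun w => a%:E * (EFin \o f a) w)%E); last by apply/funext.
    exact: integrableZl.
  have i2 : mu.-integrable [set: R]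
      (EFin \o (fun x => 2 * k * ((x - m) * sin (a * (x - m) + c) * bell x))).
    rewrite (_ : _ \o _ = (fun w => (2 * k)%:E *
      (EFin \o (fun x => ((x - m) * sin (a * (x - m) + c) * bell x)%R)) w)%E); last by apply/funext.
    exact: integrableZl.
  exact: (integrableB measurableT i1 i2).
- apply: (cvg0_le (v := fun n => bell n%:R)).
    move=> n; rewrite normrM (ger0_norm (bell_ge0 _ _ _)) ler_piMl ?bell_ge0//.
    exact: sin_max.
  apply: (@bell_cvg0 _ _ _ k0 (fun n => n%:R)) => n.
  by rewrite -[X in X - _](@ger0_norm _ n%:R)// lerB_dist.
- apply: (cvg0_le (v := fun n => bell (- n%:R))).
    move=> n; rewrite normrM (ger0_norm (bell_ge0 _ _ _)) ler_piMl ?bell_ge0//.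
    exact: sin_max.
  apply: (@bell_cvg0 _ _ _ k0 (fun n => - n%:R)) => n.
  by rewrite -[X in X - _](@ger0_norm _ n%:R)// -(normrN n%:R) lerB_dist.
Qed.

(** The phase [c] treats the real and the imaginary part of the characteristic
function at once. *)
Lemma gauss_fourier (a : R) : \int[mu]_x (cos (a * (x - m) + c) * bell x) =
  cos c * expR (- (a ^+ 2 / (4 * k))) * \int[mu]_x bell x.
Proof.
pose g (x : R) := F x * expR (x ^+ 2 / (4 * k)).
have dg (x : R) : is_derive x (1 : R) g 0.
  have dq : is_derive x (1 : R) (fun x => x ^+ 2 / (4 * k)) (x / (2 * k)).
    have -> : (fun x => x ^+ 2 / (4 * k)) = (4 * k)^-1 *: (id ^+ 2) :> (R -> R).
      by apply/funext => y; rewrite mulrC.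
    apply: trigger_derive; rewrite /GRing.scale/= expr1.
    by rewrite /GRing.scale/=; field; rewrite gt_eqF.
  have de := @is_derive1_comp _ expR _ x _ _ (is_derive_expR _) dq.
  apply: (trigger_derive (is_deriveM (ode x) de)).
  by rewrite /GRing.scale/=; ring.
have gE : g a = g 0 by exact: is_derive_0_is_cst.
have F0 : F 0 = cos c * \int[mu]_x bell x.
  rewrite -RintegralZl//; last exact: integrable_bell.
  by apply: eq_Rintegral => x _; rewrite /f mul0r add0r.
have FE : F a = g a * expR (- (a ^+ 2 / (4 * k))).
  by rewrite /g -mulrA -expRD subrr expR0 mulr1.
by rewrite -[LHS]/(F a) FE gE /g F0 expr0n/= mul0r expR0; ring.
Qed.

End gauss_fourier.

(** * Moments and phases of Gaussian variables *)

Section normal_integral.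
Context (R : realType) (m s : R).
Local Notation mu := (@lebesgue_measure R).

Lemma integral_normal_prob (f : R -> \bar R) :
  (normal_prob m s).-integrable [set: R] f ->
  (\int[normal_prob m s]_x f x = \int[mu]_x (f x * (normal_pdf m s x)%:E))%E.
Proof.
move=> intf.
have mf : measurable_fun [set: R] f by case/integrableP : intf.
have dom := normal_prob_dominates m s.
rewrite -(Radon_Nikodym_change_of_variables dom)//=.
apply: ae_eq_integral => //.
- by apply: emeasurable_funM => //; apply: (measurable_int mu).
- by apply: emeasurable_funM => //=; apply/measurable_EFinP; exact: measurable_normal_pdf.
- apply: ae_eqe_mul2l => /=.
  rewrite Radon_NikodymE.
  case: cid => /= h [h1 h2 h3].
  apply: integral_ae_eq => //=.
  + by apply/measurable_EFinP; exact: measurable_normal_pdf.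
  + by move=> E _ mE; rewrite -h3.
Qed.

End normal_integral.

Section gaussian.
Context d (T : measurableType d) (R : realType).
Variable P : probability T R.
Local Notation E f := (Rintegral P [set: T] f).

(** The degenerate law is included: it is the case [s = 0] of the same formula. *)
Lemma gaussian_phase (Y : T -> R) : measurable_fun [set: T] Y ->
  gaussian_rv P Y -> exists m s : R, 0 <= s /\
    forall a c : R, E (fun w => cos (a * (Y w - m) + c)) =
      cos c * expR (- (a ^+ 2 * s ^+ 2 / 2)).
Proof.
move=> mY [m [s [s0 PY]]]; exists m, s; split => // a c.
pose h (x : R) := cos (a * (x - m) + c).
have mh : measurable_fun [set: R] h.
  apply: measurableT_comp; first exact: continuous_measurable_fun (@continuous_cos R).
  by apply: measurable_funD => //; apply: measurable_funM => //; exact: measurable_funB.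
have bh : bmeas h by split => //; exists 1 => x; exact: cos_max.
pose Y' : {mfun T >-> measurableTypeR R} :=
  HB.pack Y (isMeasurableFun.Build _ _ T (measurableTypeR R) Y mY).
have -> : E (fun w => cos (a * (Y w - m) + c)) = \int[distribution P Y']_x h x.
  congr fine; rewrite integral_distribution//.
    exact/measurable_EFinP.
  have := bmeas_integrable P (f := h \o Y).
  apply; split; first exact: measurableT_comp.
  by exists 1 => x; exact: cos_max.
have [s00|sn0] := eqVneq s 0.
  have -> : \int[distribution P Y']_x h x = \int[@dirac _ (measurableTypeR R) m R]_x h x.
    congr fine; apply: eq_measure_integral => A mA _.
    by rewrite -[LHS]/(P (Y @^-1` A)) PY// s00 eqxx.
  rewrite /Rintegral integral_dirac//=; last exact/measurable_EFinP.
  by rewrite indicT mul1r /h subrr mulr0 add0r s00 expr0n/= mulr0 mul0r oppr0 expR0 mulr1.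
have -> : \int[distribution P Y']_x h x = \int[normal_prob m s]_x h x.
  congr fine; apply: eq_measure_integral => A mA _.
  by rewrite -[LHS]/(P (Y @^-1` A)) PY// (negbTE sn0).
rewrite /Rintegral integral_normal_prob; last exact: bmeas_integrable.
have sp : 0 < s by rewrite lt_neqAle eq_sym sn0.
pose k := (2 * s ^+ 2)^-1.
have k0 : 0 < k by rewrite invr_gt0 mulr_gt0// exprn_gt0.
pose N := normal_peak s.
have pE x : normal_pdf m s x = N * bell m k x.
  rewrite normal_pdfE// /normal_fun /bell /k; congr (_ * expR _).
  by rewrite -mulr_natl mulNr mulrC.
have -> : (\int[lebesgue_measure]_x ((h x)%:E * (normal_pdf m s x)%:E))%E =
    (\int[lebesgue_measure]_x (N * (h x * bell m k x))%:E)%E.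
  by apply: eq_integral => x _; rewrite pE -EFinM mulrCA.
have ib := integrable_bell m k0.
have ihb : lebesgue_measure.-integrable [set: R] (EFin \o (fun x => h x * bell m k x)).
  apply: le_integrable ib => //.
    apply/measurable_EFinP; apply: measurable_funM => //.
    by apply: continuous_measurable_fun; exact: continuous_bell.
  by move=> x _; rewrite /= lee_fin normrM ler_piMl ?normr_ge0//; exact: cos_max.
rewrite -/(Rintegral _ _ _) RintegralZl// gauss_fourier//.
have : \int[lebesgue_measure]_x (N * bell m k x) = 1.
  under eq_Rintegral do rewrite -pE.
  by rewrite /Rintegral integral_normal_pdf.
rewrite RintegralZl// => NE.
rewrite mulrCA NE mulr1; congr (_ * expR (- _)).
by rewrite /k; field.
Qed.

Lemma Lfun2P (f : T -> R) : measurable_fun [set: T] f ->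
  P.-integrable [set: T] (EFin \o (fun w => f w ^+ 2)) -> f \in Lfun P 2%:E.
Proof.
move=> mf /integrableP[_ i2]; apply/andP; split; rewrite inE//=.
rewrite /finite_norm unlock poweR_lty//.
apply: le_lt_trans i2; apply: ge0_le_integral => //.
- by move=> w _; exact: poweR_ge0.
- apply: (@measurableT_comp _ _ _ _ _ _ (fun x => poweR x 2)).
    exact: measurable_poweR.
  by apply: measurableT_comp => //; exact/measurable_EFinP.
- by apply: measurableT_comp => //; apply/measurable_EFinP; exact: measurable_funX.
by move=> w _ /=; rewrite lee_fin powR_mulrn// normrX.
Qed.

Lemma abs_sin_le (x : R) : `|sin x| <= `|x|.
Proof.
wlog x0 : x / 0 <= x.
  move=> h; have [/h//|/ltW x0] := leP 0 x.
  by rewrite -normrN -sinN -(normrN x) h// oppr_ge0.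
have [|c _] := @MVT_segment R sin cos 0 x x0 (fun y _ => is_derive_sin y).
  exact/continuous_subspaceT/continuous_sin.
rewrite sin0 !subr0 => ->.
by rewrite normrM ler_piMl// cos_max.
Qed.

Lemma cvg_quotient (phi : R -> R) (l : R) (u : nat -> R) :
  is_derive (0 : R) (1 : R) phi l -> phi 0 = 0 -> (forall n, u n != 0) ->
  u n @[n --> \oo] --> (0 : R) -> (u n)^-1 * phi (u n) @[n --> \oo] --> l.
Proof.
move=> [dphi dl] phi0 un0 u0.
have : (fun h : R => h^-1 *: (phi (h *: 1 + 0) - phi 0)) @ 0^' --> l.
  by rewrite -dl; exact: dphi.
move/cvgr_dnbhsP => /(_ u); move=> /(_ (conj un0 u0)).
by under eq_fun do rewrite phi0 subr0 addr0 /GRing.scale/= mulr1.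
Qed.

(** Mean and variance are read off the characteristic function at the origin: the
difference quotients [q n] of the cosine bound the second moment by the lemma of
Fatou, and dominated convergence then gives both moments exactly. *)
Lemma gaussian_moments (Y : T -> R) : measurable_fun [set: T] Y ->
  gaussian_rv P Y -> exists m s : R, [/\ 0 <= s, Y \in Lfun P 2%:E,
    E Y = m, E (fun w => (Y w - m) ^+ 2) = s ^+ 2 &
    forall a c : R, E (fun w => cos (a * (Y w - m) + c)) =
      cos c * expR (- (a ^+ 2 * s ^+ 2 / 2))].
Proof.
move=> mY /(gaussian_phase mY)[m [s [s0 Yphase]]]; exists m, s.
pose Z w := Y w - m.
have mZ : measurable_fun [set: T] Z by exact: measurable_funB.
pose e (n : nat) : R := n.+1%:R^-1.
have e0 n : e n != 0 by rewrite invr_neq0.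
have ep n : 0 < e n by rewrite invr_gt0.
have cve : e n @[n --> \oo] --> (0 : R) by exact: cvg_harmonic.
pose q n w := 2 * (e n ^+ 2)^-1 * (1 - cos (e n * Z w)).
have qE n w : q n w = ((e n / 2)^-1 * sin (e n / 2 * Z w)) ^+ 2.
  rewrite /q (_ : e n * Z w = (e n / 2 * Z w) *+ 2); last by rewrite -mulr_natl; field.
  by rewrite cos_mulr2n cos2sin2; field.
have e2 n : e n / 2 != 0 by rewrite mulf_neq0.
have cve2 : e n / 2 @[n --> \oo] --> (0 : R).
  by rewrite -[X in _ --> X](mul0r (2^-1 : R)); apply: cvgM => //; exact: cvg_cst.
have dsinZ w : is_derive (0 : R) (1 : R) (fun h => sin (h * Z w)) (Z w).
  have dl : is_derive (0 : R) (1 : R) (fun h : R => h * Z w) (Z w).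
    rewrite (_ : (fun h => _) = Z w *: id :> (R -> R)); last first.
      by apply/funext => h; rewrite mulrC.
    by apply: trigger_derive; rewrite /GRing.scale/= mulr1.
  have := @is_derive1_comp _ sin _ (0 : R) _ _ (is_derive_sin _) dl.
  by rewrite mul0r cos0 mul1r.
have cvq w : q n w @[n --> \oo] --> Z w ^+ 2.
  under eq_fun do rewrite qE expr2.
  by rewrite expr2; apply: cvgM;
    apply: (@cvg_quotient (fun h => sin (h * Z w))) => //; rewrite mul0r sin0.
have mcos a : measurable_fun [set: T] (fun w => cos (a * Z w)).
  by case: (@bmeas_cos _ _ R (fun w => a * Z w)) => //; exact: measurable_funM.
have icos a : P.-integrable [set: T] (EFin \o (fun w => cos (a * Z w))).
  by apply: bmeas_integrable; apply: bmeas_cos; exact: measurable_funM.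
have mq n : measurable_fun [set: T] (q n).
  by apply: measurable_funM => //; exact: measurable_funB.
have icst c : P.-integrable [set: T] (EFin \o (fun=> c : R)).
  by apply: bmeas_integrable; exact: bmeas_cst.
have Ecst c : E (fun=> c) = c.
  by rewrite Rintegral_cst// [X in fine X](@probability_setT _ _ _ P) mulr1.
have Eq n : E (q n) = 2 * (e n ^+ 2)^-1 * (1 - expR (- (e n ^+ 2 * s ^+ 2 / 2))).
  rewrite /q RintegralZl//; last exact: (integrableB measurableT (icst 1) (icos (e n))).
  rewrite RintegralB// Ecst; congr (_ * (1 - _)).
  have := Yphase (e n) 0; rewrite cos0 mul1r => <-.
  by apply: eq_Rintegral => w _; rewrite addr0.
have cvEq : E (q n) @[n --> \oo] --> s ^+ 2.
  have h n : E (q n) = (e n ^+ 2 / 2)^-1 * (1 - expR (- (e n ^+ 2 / 2 * s ^+ 2))).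
    rewrite Eq (_ : e n ^+ 2 * s ^+ 2 / 2 = e n ^+ 2 / 2 * s ^+ 2); last by ring.
    by congr (_ * _); field.
  under eq_fun do rewrite h.
  apply: (@cvg_quotient (fun h => 1 - expR (- (h * s ^+ 2)))).
  - have dl : is_derive (0 : R) (1 : R) (fun h : R => - (h * s ^+ 2)) (- s ^+ 2).
      rewrite (_ : (fun h => _) = (- s ^+ 2) *: id :> (R -> R)); last first.
        by apply/funext => h'; rewrite -mulrN mulrC.
      by apply: trigger_derive; rewrite /GRing.scale/= mulr1.
    have de := @is_derive1_comp _ expR _ (0 : R) _ _ (is_derive_expR _) dl.
    rewrite (_ : (fun h => _) = cst 1 - (expR \o (fun h : R => - (h * s ^+ 2))))//.
    by apply: trigger_derive; rewrite mul0r oppr0 expR0 mul1r sub0r opprK.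
  - by rewrite mul0r oppr0 expR0 subrr.
  - by move=> n; rewrite mulf_neq0// expf_neq0.
  - rewrite -[X in _ --> X](mul0r (2^-1 : R)); apply: cvgM; last exact: cvg_cst.
    under eq_fun do rewrite expr2.
    have : e n * e n @[n --> \oo] --> (0 * 0 : R) by exact: cvgM.
    by rewrite mul0r.
have q0 n w : 0 <= q n w by rewrite qE sqr_ge0.
have qZ n w : `|q n w| <= Z w ^+ 2.
  rewrite ger0_norm// qE -[leRHS]real_normK ?num_real// -[leLHS]real_normK ?num_real//.
  rewrite lerXn2r ?nnegrE// normrM normrV ?unitfE//.
  rewrite ler_pdivrMl ?normr_gt0// -normrM; exact: abs_sin_le.
have iq n : P.-integrable [set: T] (EFin \o q n).
  apply: bmeas_integrable; apply: bmeasM; first exact: bmeas_cst.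
  split; first exact: measurable_funB.
  exists 2 => w; apply: le_trans (ler_normB _ _) _.
  by rewrite normr1; have := cos_max (e n * Z w); lra.
have iZ2 : P.-integrable [set: T] (EFin \o (fun w => Z w ^+ 2)).
  apply/integrableP; split.
    by apply/measurable_EFinP; exact: measurable_funX.
  under eq_integral do rewrite /= ger0_norm ?sqr_ge0//.
  have := @fatou _ _ _ P _ measurableT (fun n w => (q n w)%:E).
  rewrite (_ : limn_einf (fun n => \int[P]_w (q n w)%:E)%E = (s ^+ 2)%:E); last first.
    have cv : (\int[P]_w (q n w)%:E)%E @[n --> \oo] --> (s ^+ 2)%:E.
      have -> : (fun n => \int[P]_w (q n w)%:E)%E = (fun n => (E (q n))%:E).
        by apply/funext => n; rewrite /Rintegral fineK//; apply: integrable_fin_num => //; exact: iq.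
      by apply: cvg_EFin; [exact: nearW|exact: cvEq].
    rewrite is_cvg_limn_einfE; first exact/cvg_lim.
    by apply/cvg_ex; eexists; exact: cv.
  move=> fat; apply: le_lt_trans (ltry (s ^+ 2)).
  apply: le_trans (fat _ _).
  - rewrite le_eqVlt; apply/orP; left; apply/eqP; apply: eq_integral => w _.
    have cv : (q n w)%:E @[n --> \oo] --> (Z w ^+ 2)%:E.
      by apply: cvg_EFin; [exact: nearW|exact: cvq].
    rewrite is_cvg_limn_einfE; first exact/esym/cvg_lim.
    by apply/cvg_ex; eexists; exact: cv.
  - by move=> n; exact/measurable_EFinP.
  - by move=> n w _; rewrite lee_fin.
have EZ2 : E (fun w => Z w ^+ 2) = s ^+ 2.
  apply: (@cvg_unique _ _ _ _ _ _ _ cvEq) => //.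
  apply: (@dominated_cvg_Rintegral _ _ _ P q _ (fun w => Z w ^+ 2)) => //.
  - exact: measurable_funX.
  - by apply: aeW => w; exact: cvq.
have Z2 : Z \in Lfun P 2%:E by exact: Lfun2P.
have P1 : P [set: T] \is a fin_num by rewrite probability_setT.
have iZ : P.-integrable [set: T] (EFin \o Z).
  by apply/Lfun1_integrable; exact: Lfun_subset12.
have EZ : E Z = 0.
  pose r n w := (e n)^-1 * sin (e n * Z w).
  have Er n : E (r n) = 0.
    rewrite /r RintegralZl//; last first.
      by apply: bmeas_integrable; apply: bmeas_sin; exact: measurable_funM.
    have := Yphase (e n) (- (pi / 2)); rewrite cosN cos_pihalf mul0r => h.
    under eq_Rintegral do rewrite -cosBpihalf.
    by rewrite h mulr0.
  have cv : E (r n) @[n --> \oo] --> E Z.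
    apply: (@dominated_cvg_Rintegral _ _ _ P r Z (fun w => `|Z w|)) => //.
    - move=> n; apply: measurable_funM => //.
      by case: (@bmeas_sin _ _ R (fun w => e n * Z w)) => //; exact: measurable_funM.
    - exact: integrable_norm.
    - move=> n w; rewrite /r normrM normrV ?unitfE//.
      rewrite ler_pdivrMl ?normr_gt0// -normrM; exact: abs_sin_le.
    - apply: aeW => w.
      by apply: (@cvg_quotient (fun h => sin (h * Z w))) => //; rewrite mul0r sin0.
  rewrite -(cvg_lim (@norm_hausdorff _ R^o) cv).
  under eq_fun do rewrite Er.
  exact: lim_cst.
have YE : Y = Z + cst m by apply/funext => w; rewrite /Z !fctE subrK.
split => //.
- rewrite YE; apply: rpredD => //; [exact: lee1n|move=> ?; exact: (@Lfun_cst _ _ _ P m 2)].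
- rewrite [in LHS]YE; have -> : E (Z + cst m) = E (fun w => Z w + m) by [].
  by rewrite RintegralD// EZ Ecst add0r.
Qed.

End gaussian.

(** * Regression in a semi-definite inner product space *)

Section semi_inner_product.
Context (R : realFieldType) (V : lmodType R) (dot : V -> V -> R).
Hypothesis dotC : forall x y, dot x y = dot y x.
Hypothesis dotDl : forall x y z, dot (x + y) z = dot x z + dot y z.
Hypothesis dotZl : forall a x z, dot (a *: x) z = a * dot x z.
Hypothesis dot_ge0 : forall x, 0 <= dot x x.

Lemma dotDr x y z : dot z (x + y) = dot z x + dot z y.
Proof. by rewrite dotC dotDl !(dotC z). Qed.

Lemma dotZr a x z : dot z (a *: x) = a * dot z x.
Proof. by rewrite dotC dotZl (dotC z). Qed.

Lemma dot0l z : dot 0 z = 0.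
Proof. by rewrite -(scale0r 0) dotZl mul0r. Qed.

Lemma dotBl x y z : dot (x - y) z = dot x z - dot y z.
Proof. by rewrite dotDl -scaleN1r dotZl mulN1r. Qed.

Lemma dotBr x y z : dot z (x - y) = dot z x - dot z y.
Proof. by rewrite dotC dotBl !(dotC z). Qed.

Lemma dot_suml (I : finType) (p : pred I) (c : I -> R) (x : I -> V) z :
  dot (\sum_(i | p i) c i *: x i) z = \sum_(i | p i) c i * dot (x i) z.
Proof.
elim/big_ind2 : _ => [|a b a' b' <- <-|i _]; first exact: dot0l.
  by rewrite dotDl.
by rewrite dotZl.
Qed.

Lemma dot_sumr (I : finType) (p : pred I) (c : I -> R) (x : I -> V) z :
  dot z (\sum_(i | p i) c i *: x i) = \sum_(i | p i) c i * dot z (x i).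
Proof. by rewrite dotC dot_suml; apply: eq_bigr => i _; rewrite (dotC z). Qed.

Lemma dot_null x y : dot x x = 0 -> dot x y = 0.
Proof.
move=> xx; apply/eqP; rewrite -sqrf_eq0; apply/negPn/negP => xy2.
have xy : dot x y != 0 by move: xy2; rewrite sqrf_eq0.
have := dot_ge0 ((- (dot y y + 1) / (2 * dot x y)) *: x + y).
rewrite dotDl !dotDr !dotZl !dotZr (dotC y x) xx !mulr0 add0r.
set c := _ / _; have -> : c * dot x y = - (dot y y + 1) / 2.
  by rewrite /c; field.
by have := dot_ge0 y; lra.
Qed.

(** [x] minus its projection on the line of [y]; when [y] is null the
coefficient is [0] and nothing is subtracted. *)
Definition resid (y x : V) : V := x - (dot x y / dot y y) *: y.

Lemma resid_orth y x : dot (resid y x) y = 0.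
Proof.
rewrite dotBl dotZl; have [y0|y0] := eqVneq (dot y y) 0.
  by rewrite y0 mulr0 subr0 dotC dot_null.
by rewrite divfK// subrr.
Qed.

Lemma resid_self y z : dot (resid y y) z = 0.
Proof. by apply: dot_null; rewrite {2}/resid dotBr dotZr resid_orth mulr0 subr0. Qed.

Lemma resid_id y x : dot x y = 0 -> resid y x = x.
Proof. by move=> xy; rewrite /resid xy mul0r scale0r subr0. Qed.

Lemma residB y x x' : resid y (x - x') = resid y x - resid y x'.
Proof.
rewrite /resid dotBl mulrBl scalerBl !opprB addrACA [RHS]addrACA.
by congr (_ + _); rewrite addrC.
Qed.

Lemma residZ y a x : resid y (a *: x) = a *: resid y x.
Proof. by rewrite /resid dotZl scalerBr scalerA mulrA. Qed.

Lemma resid_sum (I : finType) (p : pred I) (c : I -> R) (x : I -> V) y :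
  resid y (\sum_(i | p i) c i *: x i) = \sum_(i | p i) c i *: resid y (x i).
Proof.
elim/big_ind2 : _ => [|a b a' b' <- <-|i _]; last exact: residZ.
  by rewrite resid_id// dot0l.
have residN u : resid y (- u) = - resid y u by rewrite -scaleN1r residZ scaleN1r.
by rewrite -[b']opprK residB residN !opprK.
Qed.

Lemma dot_residr y x z : dot z y = 0 -> dot z (resid y x) = dot z x.
Proof. by move=> zy; rewrite dotBr dotZr zy mulr0 subr0. Qed.

Lemma cauchy_schwarz x y : dot x y ^+ 2 <= dot x x * dot y y.
Proof.
have := dot_ge0 (resid y x).
rewrite {2}/resid dotBr dotZr resid_orth mulr0 subr0 dotBl dotZl (dotC y x).
have [y0|y0] := eqVneq (dot y y) 0.
  by move=> _; rewrite y0 mulr0 (dotC x) (dot_null x y0) expr0n.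
have yp : 0 < dot y y by rewrite lt_neqAle eq_sym y0 dot_ge0.
by rewrite subr_ge0 mulrAC ler_pdivrMr// expr2.
Qed.

Section markov_residual.
Context (J : R -> Prop) (D : R -> V) (n : nat) (T : 'I_n -> R) (f : 'I_n -> R -> R).
Hypothesis JT : forall i, J (T i).
Hypothesis markovD : forall r s t, J r -> J s -> J t -> r <= s -> s <= t ->
  dot (resid (D s) (D r)) (D t) = 0.
Let A t := D t - \sum_i f i t *: D (T i).
Hypothesis orthA : forall t j, J t -> dot (A t) (D (T j)) = 0.

(** Write [x'] for [resid N x], [N = D s].  The residual [E] of [A t] on [A s] is
orthogonal to [N] and to all the [D (T i)], and [E = G - Z] up to null vectors,
where [Z] lies in the span of the past [D (T i)]' and [G] in the span of future
vectors [x'].  Past and future are orthogonal, so [<E, Z> = - <Z, Z>] vanishes and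
[E] is a future vector, orthogonal to [D r]'. *)
Lemma residual_markov r s t : J r -> J s -> J t -> r <= s -> s <= t ->
  dot (resid (A s) (A t)) (A r) = 0.
Proof.
move=> Jr Js Jt rs st; set N := D s; set E := resid (A s) (A t).
pose alpha := dot (A t) (A s) / dot (A s) (A s).
pose h i := f i t - alpha * f i s.
have DA u : D u = A u + \sum_i f i u *: D (T i) by rewrite subrK.
have ET i : dot E (D (T i)) = 0.
  by rewrite dotBl dotZl !orthA// mulr0 subr0.
have EN : dot E N = 0.
  rewrite /N DA dotDr resid_orth add0r dot_sumr big1// => i _.
  by rewrite ET mulr0.
have EE : E = D t - \sum_i h i *: D (T i) - alpha *: N.
  rewrite /E /resid -/alpha {1}/A /A -/N scalerBr !opprB.
  have -> : \sum_i h i *: D (T i) =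
      \sum_i f i t *: D (T i) - alpha *: \sum_i f i s *: D (T i).
    rewrite scaler_sumr -sumrB; apply: eq_bigr => i _.
    by rewrite /h scalerBl scalerA.
  by rewrite opprB !addrA; congr (_ + _); rewrite addrAC.
pose Z := \sum_(i | T i <= s) h i *: resid N (D (T i)).
pose G := resid N (D t) - \sum_(i | ~~ (T i <= s)) h i *: resid N (D (T i)).
have EG : E = G - Z - alpha *: resid N N.
  rewrite -[LHS](resid_id EN) EE !residB residZ resid_sum.
  rewrite /G (bigID (fun i => T i <= s))/= -/Z opprD addrA.
  by congr (_ - _); rewrite addrAC.
have past_future u v : J u -> J v -> u <= s -> s <= v ->
    dot (resid N (D v)) (resid N (D u)) = 0.
  move=> Ju Jv us sv; rewrite dotC dot_residr ?resid_orth//.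
  exact: markovD.
have pastG u : J u -> u <= s -> dot G (resid N (D u)) = 0.
  move=> Ju us; rewrite dotBl past_future// dot_suml big1 ?subr0// => i.
  by rewrite -ltNge => /ltW si; rewrite past_future ?mulr0.
have ZZ : dot Z Z = 0.
  have EZ : dot E Z = 0.
    by rewrite dot_sumr big1// => i _; rewrite dot_residr// ET mulr0.
  have GZ : dot G Z = 0.
    by rewrite dot_sumr big1// => i Ti; rewrite pastG// mulr0.
  move: EZ; rewrite EG dotBl dotBl GZ dotZl resid_self mulr0 subr0 sub0r.
  by move/eqP; rewrite oppr_eq0 => /eqP.
have Er : dot E (D r) = 0.
  rewrite -(dot_residr (D r) EN) EG dotBl dotBl pastG// (dot_null _ ZZ).
  by rewrite dotZl resid_self mulr0 !subr0.
rewrite dotBr Er dot_sumr big1 ?subr0// => i _.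
by rewrite ET mulr0.
Qed.

End markov_residual.

(** Normal equations: they are solvable even when the Gram matrix is singular,
because a null combination of the [v i] is orthogonal to everything. *)
Lemma regression n (v : 'I_n -> V) (w : V) j :
  let G := \matrix_(i, j) dot (v i) (v j) in
  let c := (\row_j dot w (v j)) *m pinvmx G in
  dot (w - \sum_i c 0 i *: v i) (v j) = 0.
Proof.
move=> G c; rewrite dotBl dot_suml.
suff cG : c *m G = \row_j dot w (v j).
  have := congr1 (fun M : 'rV[R]_n => M 0 j) cG; rewrite !mxE => <-.
  by apply/eqP; rewrite subr_eq0; apply/eqP/eq_bigr => i _; rewrite !mxE.
rewrite /c mulmxKpV// submxE; apply/eqP/matrixP => i0 k; rewrite !mxE.
pose x i := cokermx G i k.
have Gx i : \sum_j dot (v i) (v j) * x j = 0.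
  have := congr1 (fun M : 'M[R]_n => M i k) (mulmx_coker G); rewrite !mxE => Gk.
  by rewrite -[RHS]Gk; apply: eq_bigr => l _; congr (_ * _); rewrite mxE.
pose z := \sum_i x i *: v i.
have zz : dot z z = 0.
  rewrite {1}/z dot_suml big1// => i _.
  rewrite dot_sumr -[X in _ * X](_ : 0 = _) ?mulr0//.
  by rewrite -[LHS](Gx i); apply: eq_bigr => l _; rewrite mulrC.
rewrite -[RHS](dot_null w zz) dotC dot_sumr.
by apply: eq_bigr => l _; rewrite [RHS]mulrC; congr (_ * _); rewrite mxE.
Qed.

End semi_inner_product.

(** * Covariance on square integrable variables *)

Section L2.
Context d (T : measurableType d) (R : realType).
Variable P : probability T R.
Local Notation E f := (Rintegral P [set: T] f).
Definition L2 : lmodType R := LfunType P (lee1n 2).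
Implicit Types X Y Z : L2.

Definition cov (X Y : L2) : R := fine (covariance P X Y).

Let L2in X : (X : T -> R) \in Lfun P 2%:E. Proof. exact: LfunP. Qed.
Let L1in X : (X : T -> R) \in Lfun P 1.
Proof. by apply: (Lfun_subset12 _ (L2in X)); exact: fin_num_measure. Qed.
Let LMin X Y : ((X : T -> R) * (Y : T -> R)) \in Lfun P 1.
Proof. exact: Lfun2_mul_Lfun1. Qed.
Let covfin X Y : covariance P X Y \is a fin_num.
Proof. exact: covariance_fin_num. Qed.

Lemma covC X Y : cov X Y = cov Y X.
Proof. by rewrite /cov covarianceC. Qed.

Lemma covDl X Y Z : cov (X + Y) Z = cov X Z + cov Y Z.
Proof.
rewrite /cov -fineD//; congr fine.
by have := @covarianceDl _ _ _ P X Y Z (L2in X) (L2in Y) (L2in Z).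
Qed.

Lemma covZl a X Z : cov (a *: X) Z = a * cov X Z.
Proof.
rewrite /cov -[a in RHS]/(fine a%:E) -fineM//; congr fine.
have := @covarianceZl _ _ _ P a X Z (L1in X) (L1in Z) (LMin X Z) => <-.
by congr covariance; apply/funext => w; rewrite /= mulrC.
Qed.

Lemma cov_ge0 X : 0 <= cov X X.
Proof. by rewrite fine_ge0// variance_ge0. Qed.

Lemma covE X Y : cov X Y = E (fun w => (X w - E X) * (Y w - E Y)).
Proof. by rewrite /cov !unlock. Qed.

Lemma L2_measurable X : measurable_fun [set: T] (X : T -> R).
Proof. exact: measurable_funPT. Qed.

Lemma L2_integrable X : P.-integrable [set: T] (EFin \o X).
Proof. by apply/Lfun1_integrable. Qed.

Lemma L2M_integrable X Y : P.-integrable [set: T] (EFin \o (fun w => X w * Y w)).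
Proof. by apply/Lfun1_integrable; exact: LMin. Qed.

Lemma meanD X Y : E (X + Y : L2) = E X + E Y.
Proof. by rewrite -RintegralD//; exact: L2_integrable. Qed.

Lemma meanZ a X : E (a *: X : L2) = a * E X.
Proof. by rewrite -RintegralZl//; exact: L2_integrable. Qed.

(** The characteristic function of the normal law with the mean and the variance of
[X], in real form: [c = 0] and [c = - pi / 2] are its real and imaginary parts. *)
Definition phase_gaussian X : Prop := forall c : R,
  E (fun w => cos (X w + c)) = cos (E X + c) * expR (- (cov X X / 2)).

Lemma gaussian_phase_gaussian X : gaussian_rv P X -> phase_gaussian X.
Proof.
move=> gX; have [m [s [s0 _ Em Es phase]]] := gaussian_moments (L2_measurable X) gX.
have vE : cov X X = s ^+ 2.
  by rewrite covE -Es Em; apply: eq_Rintegral => w _; rewrite expr2.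
move=> c; have := phase 1 (m + c); rewrite expr1n mul1r -vE -Em => <-.
by apply: eq_Rintegral => w _; congr cos; ring.
Qed.

(** By the product formulas both sides are combinations of phases of [X + Y] and
[X - Y], whose variances are the sum of those of [X] and [Y]. *)
Lemma orthogonal_phases X Y c c' : cov X Y = 0 ->
  phase_gaussian X -> phase_gaussian Y ->
  phase_gaussian (X + Y) -> phase_gaussian (X - Y) ->
  E (fun w => cos (X w + c) * cos (Y w + c')) =
  E (fun w => cos (X w + c)) * E (fun w => cos (Y w + c')).
Proof.
move=> XY gX gY gD gB.
have -> : E (fun w => cos (X w + c) * cos (Y w + c')) =
    E (fun w => 2^-1 * (cos ((X + Y : L2) w + (c + c')) + cos ((X - Y : L2) w + (c - c')))).
  apply: eq_Rintegral => w _.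
  rewrite (_ : (X + Y : L2) w + (c + c') = (X w + c) + (Y w + c')); last first.
    by rewrite -[(X + Y : L2) w]/(X w + Y w); ring.
  rewrite (_ : (X - Y : L2) w + (c - c') = (X w + c) - (Y w + c')); last first.
    by rewrite -[(X - Y : L2) w]/(X w - Y w); ring.
  by move: (X w + c) (Y w + c') => x y; rewrite cosB cosD; field.
have icos Z a : P.-integrable [set: T] (EFin \o (fun w => cos (Z w + a))).
  apply: bmeas_integrable; apply: bmeas_cos.
  by apply: measurable_funD; [exact: (L2_measurable Z)|exact: measurable_cst].
rewrite RintegralZl//; last exact: (integrableD measurableT (icos (X + Y) _) (icos (X - Y) _)).
rewrite RintegralD// gD gB gX gY.
have YX : cov Y X = 0 by rewrite covC.
have covDr Z Z' W : cov W (Z + Z') = cov W Z + cov W Z' by exact: (dotDr covC covDl).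
have covNl Z W : cov (- Z) W = - cov Z W by rewrite -scaleN1r covZl mulN1r.
have covNr Z W : cov W (- Z) = - cov W Z by rewrite covC covNl covC.
have -> : cov (X + Y) (X + Y) = cov X X + cov Y Y.
  by rewrite covDl !covDr XY YX addr0 add0r.
have -> : cov (X - Y) (X - Y) = cov X X + cov Y Y.
  by rewrite covDl !covDr !covNl !covNr XY YX opprK oppr0 addr0 add0r.
rewrite (_ : E (X - Y : L2) = E X - E Y); last first.
  by rewrite -scaleN1r meanD meanZ mulN1r.
rewrite meanD.
rewrite (_ : E X + E Y + (c + c') = (E X + c) + (E Y + c')); last by ring.
rewrite (_ : E X - E Y + (c - c') = (E X + c) - (E Y + c')); last by ring.
move: (E X + c) (E Y + c') => x y; rewrite cosB cosD mulrACA -expRD.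
rewrite (_ : - (cov X X / 2) + - (cov Y Y / 2) = - ((cov X X + cov Y Y) / 2)); last by field.
by field.
Qed.

End L2.

(** * Independence in a Gaussian space *)

Section mean_swap.
Context d (T : measurableType d) (R : realType).
Variable P : probability T R.
Local Notation E f := (Rintegral P [set: T] f).

Lemma integrable_sub (f g : T -> R) : P.-integrable [set: T] (EFin \o f) ->
  P.-integrable [set: T] (EFin \o g) ->
  P.-integrable [set: T] (EFin \o (fun w => f w - g w)).
Proof. by move=> i1 i2; exact: (integrableB measurableT i1 i2). Qed.

Lemma mean_swap f g : bmeas f -> P.-integrable [set: T] (EFin \o g) ->
  E (fun w => f w * (g w - E g)) = E (fun w => f w * g w) - E f * E g /\
  E (fun w => g w * (f w - E f)) = E (fun w => f w * g w) - E f * E g.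
Proof.
move=> bf ig; have ifg := integrable_bmeasM bf ig.
have iF := bmeas_integrable P bf.
split.
  transitivity (E (fun w => f w * g w - f w * E g)).
    by apply: eq_Rintegral => w _; rewrite mulrBr.
  rewrite RintegralB//; first by rewrite RintegralZr.
  by apply: bmeas_integrable; apply: bmeasM => //; exact: bmeas_cst.
transitivity (E (fun w => f w * g w - E f * g w)).
  by apply: eq_Rintegral => w _; rewrite mulrBr [g w * _]mulrC [g w * _]mulrC.
rewrite RintegralB//; first by rewrite RintegralZl.
by apply: integrable_bmeasM => //; exact: bmeas_cst.
Qed.

Lemma preimage_sigma (f : T -> R) :
  sigma_algebra [set: T] (preimage_set_system [set: T] f (@measurable _ R)).
Proof. by apply: sigma_algebra_preimage; exact: sigma_algebra_measurable. Qed.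

End mean_swap.

Section independence.
Context d (T : measurableType d) (R : realType).
Variable P : probability T R.
Local Notation E f := (Rintegral P [set: T] f).
Local Notation L2 := (L2 P).
Local Notation cov := (@cov _ T R P).

Lemma mean_cst c : E (fun=> c) = c.
Proof. by rewrite Rintegral_cst// [X in fine X](@probability_setT _ _ _ P) mulr1. Qed.

Lemma mean_indic A : measurable A -> E \1_A = fine (P A).
Proof. by move=> mA; rewrite /Rintegral integral_indic// setIT. Qed.

Lemma sigma_generated_measurable J (X : R -> T -> R) :
  (forall u, J u -> measurable_fun [set: T] (X u)) ->
  sigma_generated J X `<=` measurable.
Proof.
move=> mX; apply: smallest_sub; first exact: sigma_algebra_measurable.
by move=> _ [u Ju [B mB <-]]; exact: mX.
Qed.

Lemma sigma_generated_preimage (J : set R) (X : R -> T -> R) u B : J u ->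
  measurable B -> sigma_generated J X (X u @^-1` B).
Proof.
move=> Ju mB; apply: sub_sigma_algebra; exists u => //; exists B => //.
by rewrite setTI.
Qed.

Lemma mean_center f g : bmeas f -> bmeas g ->
  E (fun w => f w * (g w - E g)) = E (fun w => f w * g w) - E f * E g.
Proof. by move=> bf /(bmeas_integrable P) ig; have [] := mean_swap bf ig. Qed.

Variable S : set L2.
Hypothesis S0 : S 0.
Hypothesis Slin : forall a X Y, S X -> S Y -> S (a *: X + Y).
Hypothesis gaussS : forall X, S X -> phase_gaussian X.

Let SZ a X : S X -> S (a *: X).
Proof. by move=> SX; rewrite -[_ *: _]addr0; exact: Slin. Qed.

(** [trig_orthogonal] is applied twice: first to the centered phases of [U], which
are orthogonal to the trigonometric functions of the family, and then to the
centered indicator of [A], which is thereby orthogonal to those of [U]. *)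
Lemma orthogonal_independent U (J : set R) (X : R -> T -> R) A B : S U ->
  (forall u, J u -> exists Y : L2, [/\ S Y, X u = Y & cov U Y = 0]) ->
  sigma_generated J X A -> measurable B ->
  E (fun w => \1_(U @^-1` B) w * (\1_A w - E \1_A)) = 0.
Proof.
move=> SU UX sA mB.
have mX u : J u -> measurable_fun [set: T] (X u).
  by move=> /UX[Y [_ -> _]]; exact: L2_measurable.
have mA := sigma_generated_measurable mX sA.
have bA : bmeas (\1_A : T -> R) by exact: bmeas_indic.
pose F0 : set (T -> R) := [set f : T -> R | exists2 Y : L2, S Y /\ cov U Y = 0 & f = Y].
have F0lin : linear_family F0.
  split; first by exists 0 => //; split => //; rewrite covC (dot0l (covZl (P := P))).
  move=> a f g [Y [SY UY] ->] [Z [SZ' UZ] ->].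
  exists (a *: Y + Z) => //; split; first exact: Slin.
  by rewrite covC covDl covZl !(covC _ U) UY UZ mulr0 addr0.
have bcos (Y : L2) c : bmeas (fun w => cos (Y w + c)).
  by apply: bmeas_cos; apply: measurable_funD; [exact: (L2_measurable Y)|exact: measurable_cst].
have prod (a : R) c (Y : L2) c' : S Y -> cov U Y = 0 ->
    E (fun w => cos (Y w + c') * (cos ((a *: U : L2) w + c) -
      E (fun w => cos ((a *: U : L2) w + c)))) = 0.
  move=> SY UY; rewrite mean_center// orthogonal_phases ?subrr//.
  - by rewrite covC covZl UY mulr0.
  - exact: gaussS.
  - by apply: gaussS; exact: SZ.
  - by apply: gaussS; rewrite addrC; exact: Slin.
  - by apply: gaussS; rewrite addrC -scaleNr; exact: Slin.
have sincos (x : R) : sin x = cos (x + - (pi / 2)) by rewrite cosBpihalf.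
have UA (a : R) c : E (fun w => \1_A w * (cos ((a *: U : L2) w + c) -
      E (fun w => cos ((a *: U : L2) w + c)))) = 0.
  apply: (trig_orthogonal F0lin _ _ _ _ _ sA).
  - by move=> _ [Y _ ->]; exact: L2_measurable.
  - by apply: bmeas_integrable; apply: bmeasD => //; exact: bmeas_cst.
  - move=> _ [Y [SY UY] ->]; have := prod a c Y 0 SY UY.
    by under eq_Rintegral do rewrite addr0.
  - move=> _ [Y [SY UY] ->]; under eq_Rintegral do rewrite sincos.
    exact: prod.
  - by move=> u /UX[Y [SY -> UY]]; exists Y.
pose F1 : set (T -> R) := [set f : T -> R | exists a : R, f = (a *: U : L2)].
have F1lin : linear_family F1.
  split; first by exists 0; apply/funext => w; rewrite scale0r.
  move=> a f g [b ->] [c ->]; exists (a * b + c).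
  by apply/funext => w; rewrite scalerDl -scalerA.
have AU (a c : R) : E (fun w => cos ((a *: U : L2) w + c) * (\1_A w - E \1_A)) = 0.
  rewrite mean_center// mulrC -[RHS](UA a c) mean_center//.
  by congr (_ - _); apply: eq_Rintegral => w _; rewrite mulrC.
apply: (@trig_orthogonal _ _ _ P F1 _ [set 0] (fun=> U)) => //.
- by move=> _ [a ->]; exact: L2_measurable.
- by apply: bmeas_integrable; apply: bmeasD => //; exact: bmeas_cst.
- move=> _ [a ->]; have := AU a 0.
  by under eq_Rintegral do rewrite addr0.
- move=> _ [a ->]; under eq_Rintegral do rewrite sincos.
  exact: AU.
- by move=> u _; exists 1; rewrite scale1r.
- exact: (@sigma_generated_preimage [set 0] (fun=> U : T -> R) 0).
Qed.

Lemma independent_events B A : measurable A -> measurable B ->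
  E (fun w => \1_B w * (\1_A w - E \1_A)) = 0 -> P (B `&` A) = (P B * P A)%E.
Proof.
move=> mA mB; rewrite mean_center; [|exact: bmeas_indic..].
rewrite !mean_indic//.
have -> : E (fun w => \1_B w * \1_A w) = E \1_(B `&` A).
  by apply: eq_Rintegral => w _; rewrite !indicE in_setI; case: (w \in B); rewrite ?mul1r ?mul0r.
rewrite mean_indic; last exact: measurableI.
have fin C : measurable C -> P C \is a fin_num by move=> mC; exact: fin_num_measure.
move=> /eqP; rewrite subr_eq0 => /eqP h.
by rewrite -(fineK (fin _ (measurableI _ _ mB mA))) h EFinM !fineK ?fin.
Qed.

End independence.

(** * Markov property and covariance *)

Section gaussian_markov.
Context d (T : measurableType d) (R : realType).
Variable P : probability T R.
Local Notation E f := (Rintegral P [set: T] f).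
Local Notation L2 := (L2 P).
Local Notation cov := (@cov _ T R P).
Variable S : set L2.
Hypothesis S0 : S 0.
Hypothesis Slin : forall a X Y, S X -> S Y -> S (a *: X + Y).
Hypothesis gaussS : forall X, S X -> phase_gaussian X.
Variables (a b : R) (X : R -> T -> R) (XL : R -> L2).
Hypothesis XLE : forall t, t \in `[a, b] -> (XL t : T -> R) = X t.
Hypothesis SX : forall t, t \in `[a, b] -> S (XL t).

Let SB c U V : S U -> S V -> S (U - c *: V).
Proof. by move=> SU SV; rewrite addrC -scaleNr; exact: Slin. Qed.

Let mX t : t \in `[a, b] -> measurable_fun [set: T] (X t).
Proof. by move=> tab; rewrite -XLE//; exact: L2_measurable. Qed.

Let sub_itv s u : s \in `[a, b] -> u \in `[a, s] -> u \in `[a, b].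
Proof.
rewrite !in_itv/= => /andP[_ sb] /andP[au us]; apply/andP; split => //.
exact: le_trans sb.
Qed.

Let own_measurable s : s \in `[a, b] -> own_filtration a X s `<=` measurable.
Proof.
by move=> sab; apply: sigma_generated_measurable => u /= us; exact/mX/(sub_itv sab).
Qed.

Let present_measurable s : s \in `[a, b] -> sigma_generated [set s] X `<=` measurable.
Proof. by move=> sab; apply: sigma_generated_measurable => u ->; exact: mX. Qed.

Let present_own s : s \in `[a, b] -> sigma_generated [set s] X `<=` own_filtration a X s.
Proof.
move=> sab; apply: smallest_sub; first exact: smallest_sigma_algebra.
move=> _ [u -> [B mB <-]]; rewrite setTI; apply: sigma_generated_preimage => //.
by move: sab; rewrite /= !in_itv/= lexx => /andP[->].
Qed.

(** The part [V] of [X r] not explained by [X s] is measurable for the past, so the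
Markov property applies to the events of [V]; these are independent of [X s], hence
of any conditional probability given [X s], hence of [X t]. *)
Lemma markov_uncorrelated r s t : markov_process P a b X ->
  r \in `[a, b] -> s \in `[a, b] -> t \in `[a, b] -> r <= s -> s <= t ->
  cov (resid cov (XL s) (XL r)) (XL t) = 0.
Proof.
move=> mkX rab sab tab rs st.
(* an opaque [V] prevents rewriting by linearity inside its mean *)
have [V VE] : exists V, V = resid cov (XL s) (XL r) by eexists.
rewrite -VE.
have SV : S V by rewrite VE; apply: SB; exact: SX.
have VN : cov V (XL s) = 0.
  rewrite VE.
  exact: (resid_orth (@covC _ T R P) (@covDl _ T R P) (@covZl _ T R P)
    (@cov_ge0 _ T R P)).
have mV : measurable_fun [set: T] (V : T -> R) by exact: L2_measurable.
pose VF := preimage_set_system [set: T] (V : T -> R) (@measurable _ R).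
pose T1 := g_sigma_algebraType (\bigcup_(u in `[a, s])
  preimage_set_system [set: T] (X u) (@measurable _ R)).
have mX1 u : u \in `[a, s] -> measurable_fun [set: T1] (X u : T1 -> R).
  move=> us _ C mC; rewrite setTI.
  exact: (@sigma_generated_preimage _ _ _ `[a, s]%classic X u C us mC).
have VFown A : VF A -> own_filtration a X s A.
  move=> [C mC <-].
  have mV1 : measurable_fun [set: T1] (V : T1 -> R).
    rewrite (_ : (V : T -> R) = (fun w => X r w -
        cov (XL r) (XL s) / cov (XL s) (XL s) * X s w)); last first.
      by rewrite VE -(XLE rab) -(XLE sab).
    apply: measurable_funB; last apply: measurable_funM => //; apply: mX1.
      by move: rab; rewrite !in_itv/= rs => /andP[->].
    by move: sab; rewrite !in_itv/= lexx => /andP[->].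
  exact: mV1.
have mVF : VF `<=` measurable by move=> A /VFown /(own_measurable sab).
have bA A : VF A -> bmeas (\1_A : T -> R) by move=> /mVF mA; exact: bmeas_indic.
have igA A : VF A -> P.-integrable [set: T] (EFin \o (fun w => \1_A w - E \1_A : R)).
  by move=> /bA bA'; apply: bmeas_integrable; apply: bmeasD => //; exact: bmeas_cst.
(* the common version [Y] of the conditional probabilities is a function of the
   present, of which [V] is independent *)
have future A : VF A -> forall B, measurable B ->
    E (fun w => \1_(X t @^-1` B) w * (\1_A w - E \1_A)) = 0.
  move=> VA B mB; have [Y [[_ iY YA] [Ypres _ _]]] := mkX s t sab tab st B mB.
  have mA := mVF _ VA; have mE : measurable (X t @^-1` B).
    by rewrite -[_ @^-1` _]setTI; exact: (mX tab).
  have pA C : sigma_generated [set s] X C ->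
      E (fun w => \1_C w * (\1_A w - E \1_A)) = 0.
    move=> sC; have mC := present_measurable sab sC.
    have bC : bmeas (\1_C : T -> R) by exact: bmeas_indic.
    have [h1 h2] := mean_swap (bA _ VA) (bmeas_integrable P bC).
    rewrite h2 -h1.
    case: VA => D mD <-; rewrite setTI.
    apply: (orthogonal_independent S0 Slin gaussS SV _ sC mD) => u ->.
    by exists (XL s); split => //; [exact: SX|rewrite XLE].
  have EYA : E (fun w => Y w * (\1_A w - E \1_A)) = 0.
    apply: (sigma_orthogonal _ (present_measurable sab) (igA _ VA) pA).
    - exact: smallest_sigma_algebra.
    - by move=> C mC; apply: Ypres; exists C => //; rewrite setTI.
    - have := integrable_bmeasM (f := fun w => \1_A w - E \1_A) _ iY.
      rewrite (_ : (fun w => Y w * _) = (fun w => (\1_A w - E \1_A) * Y w)); last first.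
        by apply/funext => w; rewrite mulrC.
      by apply; apply: bmeasD; [exact: bA|exact: bmeas_cst].
  have [_ EY] := mean_swap (bA _ VA) iY; move: EYA; rewrite EY => EYA.
  have [_ ->] := mean_swap (bA _ VA) (bmeas_integrable P (bmeas_indic R mE)).
  rewrite -[RHS]EYA; congr (_ - _ * _).
    transitivity (fine (P (X t @^-1` B `&` A))).
      rewrite -mean_indic; last exact: measurableI.
      apply: eq_Rintegral => w _; rewrite !indicE in_setI mulrC.
      by case: (w \in A); rewrite ?andbT ?andbF ?mulr1 ?mulr0.
    rewrite -(YA _ (VFown _ VA)) -/(Rintegral P A Y) Rintegral_mkcond.
    by apply: eq_Rintegral => w _; rewrite patchE indicE; case: (w \in A); rewrite ?mul1r ?mul0r.
  have ownT : own_filtration a X s [set: T].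
    by rewrite -(setD0 [set: T]); apply: sigma_algebraCD; exact: sigma_algebra0.
  by rewrite mean_indic// [RHS]/Rintegral (YA _ ownT) setIT.
have XA A : VF A -> E (fun w => X t w * (\1_A w - E \1_A)) = 0.
  move=> VA; apply: (sigma_orthogonal (preimage_sigma (X t)) _ (igA _ VA)).
  - by move=> _ [C mC <-]; exact: (mX tab).
  - by move=> _ [C mC <-]; rewrite setTI; exact: future.
  - by move=> C mC; exists C => //; rewrite setTI.
  - have := integrable_bmeasM (f := fun w => \1_A w - E \1_A) _ (L2_integrable (XL t)).
    rewrite XLE// (_ : (fun w => X t w * _) = (fun w => (\1_A w - E \1_A) * X t w)); last first.
      by apply/funext => w; rewrite mulrC.
    by apply; apply: bmeasD; [exact: bA|exact: bmeas_cst].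
have iXc : P.-integrable [set: T] (EFin \o (fun w => XL t w - E (XL t))).
  apply: integrable_sub; first exact: L2_integrable.
  by apply: bmeas_integrable; exact: bmeas_cst.
have VX : E (fun w => V w * (XL t w - E (XL t))) = 0.
  apply: (sigma_orthogonal (preimage_sigma V) mVF iXc).
  - move=> A VA; have [h1 h2] := mean_swap (bA _ VA) (L2_integrable (XL t)).
    by rewrite h1 -h2 XLE//; exact: XA.
  - by move=> C mC; exists C => //; rewrite setTI.
  - have iVc : P.-integrable [set: T] (EFin \o (fun w => V w * XL t w - E (XL t) * V w)).
      apply: integrable_sub; first exact: L2M_integrable.
      by apply: (integrable_bmeasM (f := fun=> _)); [exact: bmeas_cst|exact: L2_integrable].
    move: iVc; congr (_.-integrable _ (EFin \o _)); apply/funext => w; ring.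
rewrite covE.
transitivity (E (fun w => V w * (XL t w - E (XL t)) - E V * (XL t w - E (XL t)))).
  by apply: eq_Rintegral => w _; rewrite mulrBl.
rewrite RintegralB//; last 2 first.
- have iVc : P.-integrable [set: T] (EFin \o (fun w => V w * XL t w - E (XL t) * V w)).
    apply: integrable_sub; first exact: L2M_integrable.
    by apply: (integrable_bmeasM (f := fun=> _)); [exact: bmeas_cst|exact: L2_integrable].
  by move: iVc; congr (_.-integrable _ (EFin \o _)); apply/funext => w; ring.
- by apply: integrable_bmeasM => //; exact: bmeas_cst.
rewrite VX RintegralZl// RintegralB//; last 2 first.
- exact: L2_integrable.
- by apply: bmeas_integrable; exact: bmeas_cst.
by rewrite mean_cst subrr mulr0 subrr.
Qed.

(** [X t = U + al * X s] with [U] independent of the past, so by Fubini the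
conditional probability of [X t \in B] is the function [h x = P (U + al * x \in B)]
evaluated at [X s]. *)
Lemma markov_of_uncorrelated :
  (forall r s t, r \in `[a, b] -> s \in `[a, b] -> t \in `[a, b] ->
    r <= s -> s <= t -> cov (resid cov (XL s) (XL t)) (XL r) = 0) ->
  markov_process P a b X.
Proof.
move=> orth s t sab tab st B mB.
set U := resid cov (XL s) (XL t).
pose al := cov (XL t) (XL s) / cov (XL s) (XL s).
have XtE w : X t w = U w + al * X s w.
  by rewrite -(XLE tab) -(XLE sab) -[U w]/(XL t w - al * XL s w) subrK.
have SU : S U by apply: SB; exact: SX.
have mU : measurable_fun [set: T] (U : T -> R) by exact: L2_measurable.
pose U' : {mfun T >-> R} := HB.pack (U : T -> R) (isMeasurableFun.Build _ _ T R U mU).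
pose PU := distribution P U'.
have indep A C : own_filtration a X s A -> measurable C ->
    P (A `&` U @^-1` C) = (P A * PU C)%E.
  move=> sA mC; rewrite setIC muleC.
  have mUC : measurable (U @^-1` C) by rewrite -[_ @^-1` _]setTI; exact: (L2_measurable U).
  apply: independent_events => //; first exact: (own_measurable sab).
  apply: (orthogonal_independent S0 Slin gaussS SU _ sA mC) => u /= us.
  have uab := sub_itv sab us.
  exists (XL u); split; [exact: SX|by rewrite XLE|].
  by apply: orth => //; move: us; rewrite in_itv/= => /andP[].
pose Sx : set (R * R) := [set z | B (z.2 + al * z.1)].
have mSx : measurable Sx.
  rewrite -[Sx]setTI.
  suff : measurable_fun [set: R * R] (fun z : R * R => z.2 + al * z.1) by exact.
  by apply: measurable_funD => //; exact: measurable_funM.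
pose h x := fine (PU (xsection Sx x)).
have mPU x : measurable (xsection Sx x) by exact: measurable_xsection.
have mh : measurable_fun [set: R] h.
  by apply: measurableT_comp => //; exact: measurable_fun_xsection.
have hE x : (h x)%:E = PU (xsection Sx x) by rewrite fineK// fin_num_measure.
pose Y w := h (X s w).
have bY : bmeas Y.
  split; first exact: (measurableT_comp mh (mX sab)).
  exists 1 => w; rewrite ger0_norm ?fine_ge0// -lee_fin hE.
  exact: probability_le1.
have mY C : measurable C -> sigma_generated [set s] X (Y @^-1` C).
  move=> mC; rewrite (_ : Y @^-1` C = X s @^-1` (h @^-1` C))//.
  by apply: sigma_generated_preimage => //; rewrite -[_ @^-1` _]setTI; exact: mh.
have main A : own_filtration a X s A ->
    (\int[P]_(w in A) (Y w)%:E = P (X t @^-1` B `&` A))%E.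
  move=> sA.
  pose T1 := g_sigma_algebraType (\bigcup_(u in `[a, s])
    preimage_set_system [set: T] (X u) (@measurable _ R)).
  have mid : measurable_fun [set: T] (idfun : T -> T1).
    by move=> _ C sC; rewrite setTI; exact: (own_measurable sab).
  (* the law of the pair ([w], [U w]) on the past times the line is a product *)
  pose idm : {mfun T >-> T1} := HB.pack (idfun : T -> T1)
    (isMeasurableFun.Build _ _ T T1 (idfun : T -> T1) mid).
  pose m1 := distribution P idm.
  have mpair : measurable_fun [set: T] (fun w => (w : T1, U w : R)).
    exact: (measurable_fun_pair mid mU).
  pose pairm : {mfun T >-> (T1 * R)%type} := HB.pack (fun w : T => (w : T1, U w : R))
    (isMeasurableFun.Build _ _ T (T1 * R)%type (fun w : T => (w : T1, U w : R)) mpair).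
  pose m' := distribution P pairm.
  have mXs : measurable_fun [set: T1] (X s : T1 -> R).
    move=> _ C mC; rewrite setTI; apply: sigma_generated_preimage => //.
    by move: sab; rewrite /= !in_itv/= lexx => /andP[->].
  pose Q : set (T1 * R) := [set z | A z.1 /\ Sx (X s z.1, z.2)].
  have mQ : measurable Q.
    have -> : Q = (A `*` [set: R]) `&`
        ((fun z : T1 * R => (X s z.1, z.2)) @^-1` Sx).
      by apply/seteqP; split => [z []//|z [[]]].
    apply: measurableI; first exact: measurableX.
    rewrite -[_ @^-1` _]setTI.
    suff : measurable_fun [set: T1 * R] (fun z : T1 * R => (X s z.1, z.2)) by exact.
    apply: measurable_fun_pair => //.
    exact: (measurableT_comp mXs).
  have mE : (m1 \x PU)%E Q = m' Q.
    by apply: product_measure_unique => //; exact: indep.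
  transitivity (m' Q); last first.
    rewrite -[LHS]/(P [set w | A w /\ B (U w + al * X s w)]); congr (P _).
    by apply/seteqP; split => w /=; rewrite XtE => -[].
  rewrite -mE /product_measure1.
  have secQ w : (PU \o xsection Q) w = if w \in A then (Y w)%:E else 0%E.
    rewrite /= /Y hE; case: ifPn => wA.
      congr (PU _); apply/seteqP; split => u; rewrite /xsection /= !inE /Q /=.
        by case.
      by split => //; exact: set_mem.
    rewrite (_ : xsection Q w = set0) ?measure0//.
    by apply/seteqP; split => u //; rewrite /xsection /= inE => -[/mem_set]; rewrite (negbTE wA).
  rewrite ge0_integral_distribution//.
    by rewrite integral_mkcond; apply: eq_integral => w _; rewrite patchE; exact: (esym (secQ w)).
  exact: measurable_fun_xsection.
exists Y; split; split.
- by move=> _ [C mC <-]; rewrite setTI; apply: present_own => //; exact: mY.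
- exact: bmeas_integrable.
- exact: main.
- by move=> _ [C mC <-]; rewrite setTI; exact: mY.
- exact: bmeas_integrable.
- by move=> A /(present_own sab); exact: main.
Qed.

End gaussian_markov.

(** * The Gaussian space of a sample-continuous process *)

Section clamp.
Context (R : realType) (a b : R).
Hypothesis ab : a <= b.

Definition clamp (t : R) : R := Num.max a (Num.min b t).

Lemma clamp_itv t : clamp t \in `[a, b].
Proof. by rewrite in_itv/= le_max lexx/= ge_max ab ge_min lexx. Qed.

Lemma clamp_id t : t \in `[a, b] -> clamp t = t.
Proof. by rewrite in_itv/= => /andP[at_ tb]; rewrite /clamp min_r// max_r. Qed.

Lemma clamp_continuous : continuous clamp.
Proof.
move=> t; apply: (@continuous_max _ _ (fun=> a) (fun t => Num.min b t)).
  exact: cvg_cst.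
by apply: (@continuous_min _ _ (fun=> b) (fun t => t)); [exact: cvg_cst|exact: cvg_id].
Qed.

Lemma within_cvg_clamp (f : R -> R) (u : nat -> R) s :
  {within `[a, b], continuous f} -> u n @[n --> \oo] --> s ->
  f (clamp (u n)) @[n --> \oo] --> f (clamp s).
Proof.
move=> /subspace_continuousP cf us.
have cu : clamp (u n) @[n --> \oo] --> clamp s.
  exact: (cvg_comp u clamp us (@clamp_continuous s)).
apply: (@cvg_trans _ (f @ within `[a, b] (nbhs (clamp s)))); last first.
  exact: cf (clamp_itv s).
move=> Q /= fQ; have [N _ hN] := cu _ fQ.
by exists N => // n Nn; exact: hN n Nn (clamp_itv _).
Qed.

End clamp.

Lemma continuous_sum_ord (R : realType) n (F : 'I_n -> R -> R) :
  (forall i, continuous (F i)) -> continuous (fun t => \sum_(i < n) F i t).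
Proof.
move=> cF; elim: n F cF => [|n IH] F cF t.
  rewrite (_ : (fun t => _) = (fun=> 0)); first exact: cvg_cst.
  by apply/funext => x; rewrite big_ord0.
rewrite (_ : (fun t => _) = (fun t => F ord0 t + \sum_(i < n) F (lift ord0 i) t)).
  by apply: cvgD; [exact: cF|apply: (IH (fun i => F (lift ord0 i))) => i; exact: cF].
by apply/funext => x; rewrite big_ord_recl.
Qed.

Lemma lagrange_exists (R : realType) n (T : 'I_n -> R) : injective T ->
  exists L : 'I_n -> R -> R,
    (forall i, continuous (L i)) /\ (forall i j, L i (T j) = (i == j)%:R).
Proof.
move=> Tinj.
exists (fun i t => (\prod_(k | k != i) ((T i - T k)^-1 *: ('X - (T k)%:P))).[t]).
split=> [i|i j]; first exact: continuous_horner.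
rewrite horner_prod; have [<-|ij] := eqVneq i j.
  rewrite big1// => k ki; rewrite hornerZ hornerXsubC mulVf// subr_eq0.
  by apply: contra ki => /eqP/Tinj ->.
rewrite (bigD1 j) 1?eq_sym//= hornerZ hornerXsubC subrr mulr0 mul0r//.
Qed.

Section gaussian_space.
Context d (T : measurableType d) (R : realType).
Variable P : probability T R.
Local Notation E f := (Rintegral P [set: T] f).
Local Notation L2 := (L2 P).
Local Notation cov := (@cov _ T R P).
Variables (a b : R) (D : R -> T -> R).
Hypothesis ab : a <= b.
Hypothesis procD : is_process a b D.
Hypothesis contD : sample_continuous P a b D.
Hypothesis gaussD : gaussian_process P a b D.

Let D2 t : D (clamp a b t) \in Lfun P 2%:E.
Proof.
have tab := clamp_itv ab t.
have g : gaussian_rv P (D (clamp a b t)).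
  have := @gaussD 1 (fun=> clamp a b t) (fun=> 1) (fun=> tab).
  by under eq_fun do rewrite big_ord1 mul1r.
by have [m [s []]] := gaussian_moments (procD tab) g.
Qed.

(** The process as a path in the space of square integrable variables, frozen
outside of the time interval. *)
Definition path_L2 (t : R) : L2 := Lfun_Sub (lee1n 2) (D2 t).
Local Notation DL := path_L2.

Lemma path_L2E t : t \in `[a, b] -> (DL t : T -> R) = D t.
Proof. by move=> tab; rewrite -[in RHS](clamp_id tab). Qed.

Definition gaussian_span : set L2 :=
  [set X | exists k (t c : 'I_k -> R), X = \sum_i c i *: DL (t i)].

Let sumE k (t c : 'I_k -> R) w :
  (\sum_i c i *: DL (t i) : L2) w = \sum_i c i * D (clamp a b (t i)) w.
Proof.
elim/big_ind2 : _ => // [X x Y y <- <-//].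
Qed.

Lemma gaussian_span0 : gaussian_span 0.
Proof. by exists 0%N, (fun=> 0), (fun=> 0); rewrite big_ord0. Qed.

Lemma gaussian_span_path t : gaussian_span (DL t).
Proof. by exists 1%N, (fun=> t), (fun=> 1); rewrite big_ord1 scale1r. Qed.

Lemma gaussian_span_lin c X Y : gaussian_span X -> gaussian_span Y ->
  gaussian_span (c *: X + Y).
Proof.
move=> [k [t [e ->]]] [k' [t' [e' ->]]].
pose glue (f : 'I_k -> R) (g : 'I_k' -> R) (i : 'I_(k + k')) :=
  match fintype.split i with inl j => f j | inr j => g j end.
exists (k + k')%N, (glue t t'), (glue (fun i => c * e i) e').
rewrite big_split_ord scaler_sumr /=; congr (_ + _); apply: eq_bigr => i _.
  by rewrite /glue (unsplitK (inl i)) scalerA.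
by rewrite /glue (unsplitK (inr i)).
Qed.

Lemma gaussian_span_phase X : gaussian_span X -> phase_gaussian X.
Proof.
move=> [k [t [c ->]]]; apply: gaussian_phase_gaussian.
have := @gaussD k (fun i => clamp a b (t i)) c (fun i => clamp_itv ab (t i)).
by congr gaussian_rv; apply/funext => w; rewrite sumE.
Qed.

(** By dominated convergence the mean of the cosine of the increment tends to [1],
and for a Gaussian increment of variance [v] it is at most [exp (- v / 2)]. *)
Lemma cvg_increment_variance (u : nat -> R) s : u n @[n --> \oo] --> s ->
  cov (DL (u n) - DL s) (DL (u n) - DL s) @[n --> \oo] --> (0 : R).
Proof.
move=> us; pose I n : L2 := DL (u n) - DL s.
pose x n := E (fun w => cos (I n w)).
have mI n : measurable_fun [set: T] (I n : T -> R) by exact: L2_measurable.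
have x1 : x n @[n --> \oo] --> (1 : R).
  have -> : 1 = E (fun=> 1 : R) by rewrite mean_cst.
  apply: (@dominated_cvg_Rintegral _ _ _ P _ _ (fun=> 1)).
  - by move=> n; case: (bmeas_cos (mI n)).
  - exact: measurable_cst.
  - by apply: bmeas_integrable; exact: bmeas_cst.
  - by move=> n w; exact: cos_max.
  - apply: filterS contD => w cw.
    rewrite -[X in _ --> X]cos0.
    apply: (cvg_comp (fun n => I n w) cos _ (@continuous_cos R 0)).
    have h := within_cvg_clamp ab cw us.
    rewrite -(subrr (D (clamp a b s) w)).
    by apply: cvgB => //; exact: cvg_cst.
pose v n := cov (I n) (I n).
have xv n : x n <= expR (- (v n / 2)).
  have gI : phase_gaussian (I n).
    apply: gaussian_span_phase; rewrite /I addrC -scaleN1r.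
    by apply: gaussian_span_lin; exact: gaussian_span_path.
  have := gI 0; under eq_Rintegral do rewrite addr0.
  rewrite /x => ->; rewrite ler_piMl ?expR_ge0//; exact: cos_le1.
have : 2 * ((x n)^-1 - 1) @[n --> \oo] --> (2 * (1^-1 - 1) : R).
  apply: cvgM; first exact: cvg_cst.
  by apply: cvgB; [apply: cvgV => //; exact: oner_neq0|exact: cvg_cst].
rewrite invr1 subrr mulr0.
apply: (@squeeze_cvgr _ _ _ _ (cst 0)); last exact: cvg_cst.
near=> n; rewrite cov_ge0/=.
have x0 : 0 < x n by near: n; apply: (cvgr_gt _ x1); exact: ltr01.
have h1 := xv n; have h2 := expR_ge1Dx (v n / 2).
have : expR (v n / 2) <= (x n)^-1.
  rewrite -[leLHS]invrK -expRN lef_pV2 ?posrE ?expR_gt0//.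
rewrite -/(v n); lra.
Unshelve. all: end_near. Qed.

Lemma continuous_cov (Z : L2) : continuous (fun t => cov (DL t) Z).
Proof.
move=> s; apply/(@cvg_nbhsP _ R^o) => u us.
apply/(@subr_cvg0 _ R^o); apply: norm_cvg0.
have h := cvg_increment_variance us.
have : Num.sqrt (cov (DL (u n) - DL s) (DL (u n) - DL s) * cov Z Z)
    @[n --> \oo] --> Num.sqrt (0 * cov Z Z).
  apply: (cvg_comp _ Num.sqrt _ (@sqrt_continuous R (0 * cov Z Z))).
  by apply: cvgM => //; exact: cvg_cst.
rewrite mul0r sqrtr0.
apply: (@squeeze_cvgr _ _ _ _ (cst 0)); last exact: cvg_cst.
near=> n; rewrite /= normr_ge0/=.
rewrite -sqrtr_sqr ler_wsqrtr//.
have -> : cov (DL (u n)) Z - cov (DL s) Z = cov (DL (u n) - DL s) Z.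
  by rewrite (dotBl (@covDl _ T R P) (@covZl _ T R P)).
exact: (cauchy_schwarz (@covC _ T R P) (@covDl _ T R P) (@covZl _ T R P) (@cov_ge0 _ T R P)).
Unshelve. all: end_near. Qed.

End gaussian_space.

(** * The Markovian arcade process *)

Unset Implicit Arguments.

Theorem theorem2p9 (R : realType) (d : measure_display)
    (Omega : measurableType d) (P : probability Omega R)
    (n : nat) (n_ge1 : (1 <= n)%N)
    (T : 'I_n.+1 -> R) (T0_ge0 : 0 <= T ord0)
    (T_incr : forall i j : 'I_n.+1, (i < j)%N -> T i < T j)
    (D : R -> Omega -> R) (D_driver : gauss_markov_driver P T D) :
  exists A : R -> Omega -> R,
    arcade_process T D A /\ markov_process P (T ord0) (T ord_max) A.
Proof.
have [[procD contD _] gaussD markovD] := D_driver.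
set a := T ord0; set b := T ord_max.
have T_le (i j : 'I_n.+1) : (i <= j)%N -> T i <= T j.
  by rewrite leq_eqVlt => /orP[/eqP/val_inj -> //|/T_incr/ltW].
have Tab i : T i \in `[a, b] by rewrite in_itv/= !T_le ?leq_ord.
have ab : a <= b by exact: T_le.
have T_inj : injective T.
  move=> i j Tij; apply/val_inj; case: (ltngtP i j) => // /T_incr.
    by rewrite Tij ltxx.
  by rewrite Tij ltxx.
have [L [contL LT]] := lagrange_exists T_inj.
pose DL := path_L2 ab procD gaussD.
have DLE t : t \in `[a, b] -> (DL t : Omega -> R) = D t by exact: path_L2E.
have cC := @covC _ Omega R P; have cD := @covDl _ Omega R P.
have cZ := @covZl _ Omega R P; have c0 := @cov_ge0 _ Omega R P.
pose v i := DL (T i).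
(* [W] vanishes at the dates, and so does its regression [k] on the values there *)
pose W t := DL t - \sum_i L i t *: v i.
pose G : 'M[R]_n.+1 := \matrix_(i, j) cov (v i) (v j).
pose k t : 'rV[R]_n.+1 := (\row_j cov (W t) (v j)) *m pinvmx G.
pose f i t := L i t + k t 0 i.
have WT j : W (T j) = 0.
  rewrite /W (bigD1 j)//= LT eqxx scale1r big1 ?addr0 ?subrr// => i ij.
  by rewrite LT (negbTE ij) scale0r.
have kT j : k (T j) = 0.
  rewrite /k WT [X in X *m _](_ : _ = 0) ?mul0mx//.
  by apply/rowP => i; rewrite !mxE (dot0l cZ).
have contk i : continuous (fun t => k t 0 i).
  rewrite (_ : (fun t => _) = (fun t => \sum_j
      (cov (DL t) (v j) - \sum_l L l t * cov (v l) (v j)) * pinvmx G j i)); last first.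
    apply/funext => t; rewrite mxE; apply: eq_bigr => j _.
    by rewrite mxE (dotBl cD cZ) (dot_suml cD cZ).
  apply: continuous_sum_ord => j t; apply: cvgM; last exact: cvg_cst.
  apply: cvgB; first exact: (@continuous_cov _ _ _ P a b D ab procD contD gaussD (v j) t).
  apply: (continuous_sum_ord (F := fun l t => L l t * cov (v l) (v j))) => l s.
  by apply: cvgM; [exact: contL|exact: cvg_cst].
pose AL t := DL t - \sum_i f i t *: v i.
have AW t : AL t = W t - \sum_i k t 0 i *: v i.
  rewrite /AL /W -addrA -opprD -big_split/=; congr (_ - _).
  by apply: eq_bigr => i _; rewrite scalerDl.
have orthA t j : t \in `[a, b] -> cov (AL t) (v j) = 0.
  by move=> _; rewrite AW; exact: (regression cC cD cZ c0).
exists (arcade T f D); split.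
  exists f => //; split=> [i|i j].
    apply: continuous_subspaceT => t.
    by apply: cvgD; [exact: contL|exact: contk].
  by rewrite /f kT mxE addr0 LT.
pose S := gaussian_span ab procD gaussD.
have S0 : S 0 by exact: gaussian_span0.
have Slin := @gaussian_span_lin _ _ _ P a b D ab procD gaussD.
have Sg := @gaussian_span_phase _ _ _ P a b D ab procD gaussD.
have SD t : S (DL t) by exact: gaussian_span_path.
have ALE t : t \in `[a, b] -> (AL t : Omega -> R) = arcade T f D t.
  move=> tab; apply/funext => w.
  have sumE : (\sum_i f i t *: v i : L2 P) w = \sum_i f i t * D (T i) w.
    transitivity (\sum_i f i t * v i w); last first.
      by apply: eq_bigr => i _; rewrite /v DLE.
    by elim/big_ind2 : _ => // x X y Y <- <-.
  by rewrite /arcade -sumE -(DLE _ tab).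
apply: (@markov_of_uncorrelated _ _ _ P S S0 Slin Sg a b _ AL ALE).
  move=> t _; rewrite /AL addrC -scaleN1r; apply: (Slin _ _ _ _ (SD t)).
  elim/big_rec : _ => // i X _ SX; exact: (Slin _ _ _ (SD _) SX).
move=> r s t rab sab tab rs st.
apply: (residual_markov cC cD cZ c0 (J := fun t => t \in `[a, b]) Tab _ orthA) => //.
move=> r' s' t' r'ab s'ab t'ab r's' s't'.
exact: (markov_uncorrelated S0 Slin Sg DLE (fun t _ => SD t) markovD).
Qed.
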